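(* Let $\Gamma$ be an oriented Jordan smooth curve, $\alpha$ an orientation preserving diffeomorphism of $\Gamma$ onto itself with a nonempty set $\Lambda$ of fixed points, and $X(\Gamma)$ a rearrangement-invariant space with nontrivial Boyd indices $\alpha_X,\beta_X$. For every $g\in C(\Gamma)$ the spectral radius of $gW$ on $X(\Gamma)$ satisfies \[ r(gW;X(\Gamma))\le\max_{\tau\in\Lambda}\Big(|g(\tau)|\max\{|\alpha'(\tau)|^{-\alpha_X},|\alpha'(\tau)|^{-\beta_X}\}\Big). \]
   Context: $X(\Gamma)$ is an r.-i. Banach function space over $(\Gamma,|d\tau|)$. Boyd indices: with Luxemburg representation $\overline X$ over $[0,|\Gamma|]$, $(E_xf)(s)=f(xs)$ if $xs\in[0,|\Gamma|]$ and $0$ otherwise, $h_X(x)=\|E_{1/x}\|_{\mathcal B(\overline X)}$, $\alpha_X=\lim_{x\to0}\log h_X(x)/\log x$, $\beta_X=\lim_{x\to\infty}\log h_X(x)/\log x$; nontrivial means $0<\alpha_X\le\beta_X<1$. $(Wf)(t)=f[\alpha(t)]$. *)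

(* Defs.v *)
From HB Require Import structures.
From mathcomp Require Import all_boot all_order all_algebra.
From mathcomp Require Import complex.
From mathcomp Require Import all_classical all_reals all_analysis measurable_realfun.
Set Implicit Arguments. Unset Strict Implicit. Unset Printing Implicit Defensive.
Import Order.TTheory GRing.Theory Num.Theory.
Import numFieldNormedType.Exports.
Local Open Scope classical_set_scope.
Local Open Scope ring_scope.

Section Defs.
Variable R : realType.
Local Notation mu := (@lebesgue_measure R).

Definition pdist (p q : R * R) : R :=
  Num.sqrt ((p.1 - q.1) ^+ 2 + (p.2 - q.2) ^+ 2).

Definition smooth_jordan_arclength (g1 g2 : R -> R) (L : R) : Prop :=
  0 < L /\
  (forall s, g1 (s + L) = g1 s /\ g2 (s + L) = g2 s) /\
  {in `[0, L[ &, forall s t, (g1 s, g2 s) = (g1 t, g2 t) -> s = t} /\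
  (forall s, derivable g1 s 1 /\ derivable g2 s 1) /\
  continuous (derive1 g1) /\ continuous (derive1 g2) /\
  (forall s, (derive1 g1 s) ^+ 2 + (derive1 g2 s) ^+ 2 = 1).

Definition curve (g1 g2 : R -> R) : set (R * R) := [set (g1 s, g2 s) | s in setT].

(* alpha is an orientation-preserving diffeomorphism of Gamma onto itself:
   alpha is a bijection of Gamma, and in the chart given by the arclength
   parametrization it lifts to a C^1 map a : R -> R with a(s+L) = a(s)+L
   and a' > 0 everywhere. *)
Definition OP_diffeo (g1 g2 : R -> R) (L : R) (alpha : R * R -> R * R) : Prop :=
  set_bij (curve g1 g2) (curve g1 g2) alpha /\
  exists a : R -> R,
    (forall s, alpha (g1 s, g2 s) = (g1 (a s), g2 (a s))) /\
    (forall s, a (s + L) = a s + L) /\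
    (forall s, derivable a s 1) /\ continuous (derive1 a) /\
    (forall s, 0 < derive1 a s).

Definition ae_eq (D : set R) (T : Type) (f h : R -> T) : Prop :=
  {ae mu, forall s, D s -> f s = h s}.

(* Banach function norm (axioms P1-P5 of Bennett-Sharpley) on the measure
   space (D, Lebesgue), acting on nonnegative measurable functions. *)
Definition nonneg_meas (D : set R) (f : R -> \bar R) : Prop :=
  measurable_fun D f /\ (forall s, (0 <= f s)%E).

Definition banach_function_norm (D : set R) (rho : (R -> \bar R) -> \bar R) : Prop :=
  (forall f, nonneg_meas D f -> (0 <= rho f)%E) /\
  (forall f, nonneg_meas D f -> (rho f = 0%E <-> ae_eq D f (fun=> 0%E))) /\
  (forall f (c : R), nonneg_meas D f -> 0 <= c ->
     rho (fun s => c%:E * f s)%E = (c%:E * rho f)%E) /\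
  (forall f h, nonneg_meas D f -> nonneg_meas D h ->
     (rho (fun s => f s + h s)%E <= rho f + rho h)%E) /\
  (forall f h, nonneg_meas D f -> nonneg_meas D h ->
     {ae mu, forall s, D s -> (h s <= f s)%E} -> (rho h <= rho f)%E) /\
  (forall (fn : nat -> R -> \bar R) f, (forall n, nonneg_meas D (fn n)) ->
     nonneg_meas D f ->
     {ae mu, forall s, D s -> (forall n, (fn n s <= fn n.+1 s)%E) /\
        (fun n => fn n s) @ \oo --> f s} ->
     (fun n => rho (fn n)) @ \oo --> rho f) /\
  (forall E, measurable E -> E `<=` D -> (mu E < +oo)%E ->
     (rho (fun s => (\1_E s)%:E) < +oo)%E) /\
  (forall E, measurable E -> E `<=` D -> (mu E < +oo)%E ->
     exists CE : R, forall f, nonneg_meas D f ->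
       (\int[mu]_(s in E) f s <= CE%:E * rho f)%E).

Definition rearrangement_invariant (D : set R) (rho : (R -> \bar R) -> \bar R) : Prop :=
  forall f h, nonneg_meas D f -> nonneg_meas D h ->
    (forall y : R, mu (D `&` [set s | (y%:E < f s)%E]) =
                   mu (D `&` [set s | (y%:E < h s)%E])) ->
    rho f = rho h.

Definition dilation (L x : R) (f : R -> \bar R) : R -> \bar R :=
  fun s => if (0 <= x * s) && (x * s <= L) then f (x * s) else 0%E.

(* ||E_{1/x}|| on \bar X (the Luxemburg representation on [0,L]) *)
Definition dilation_norm (L : R) (rho : (R -> \bar R) -> \bar R) (x : R) : \bar R :=
  ereal_sup [set rho (dilation L x^-1 f) |
               f in [set f | nonneg_meas `[0, L] f /\ (rho f <= 1)%E]].

Definition on_curve (g1 g2 : R -> R) (f : R * R -> R[i]) : R -> R[i] :=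
  fun s => f (g1 s, g2 s).

Definition modulus (g1 g2 : R -> R) (f : R * R -> R[i]) : R -> \bar R :=
  fun s => (Normc.normc (f (g1 s, g2 s)))%:E.

Definition Xnorm (g1 g2 : R -> R) (rho : (R -> \bar R) -> \bar R) (f : R * R -> R[i]) :=
  rho (modulus g1 g2 f).

Definition inX (g1 g2 : R -> R) (L : R) (rho : (R -> \bar R) -> \bar R)
    (f : R * R -> R[i]) : Prop :=
  measurable_fun `[0, L[ (fun s => complex.Re (f (g1 s, g2 s))) /\
  measurable_fun `[0, L[ (fun s => complex.Im (f (g1 s, g2 s))) /\
  (Xnorm g1 g2 rho f < +oo)%E.

(* equality in X(Gamma), i.e. |dtau|-a.e. on Gamma *)
Definition Xeq (g1 g2 : R -> R) (L : R) (f h : R * R -> R[i]) : Prop :=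
  ae_eq `[0, L[ (on_curve g1 g2 f) (on_curve g1 g2 h).

Definition Op := (R * R -> R[i]) -> (R * R -> R[i]).

Definition bounded_op (g1 g2 : R -> R) (L : R) (rho : (R -> \bar R) -> \bar R)
    (S : Op) : Prop :=
  (forall f, inX g1 g2 L rho f -> inX g1 g2 L rho (S f)) /\
  (forall f h, inX g1 g2 L rho f -> inX g1 g2 L rho h -> Xeq g1 g2 L f h ->
     Xeq g1 g2 L (S f) (S h)) /\
  (forall f h, inX g1 g2 L rho f -> inX g1 g2 L rho h ->
     Xeq g1 g2 L (S (fun t => f t + h t)) (fun t => S f t + S h t)) /\
  (forall f (c : R[i]), inX g1 g2 L rho f ->
     Xeq g1 g2 L (S (fun t => c * f t)) (fun t => c * S f t)) /\
  (exists M : R, forall f, inX g1 g2 L rho f ->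
     (Xnorm g1 g2 rho (S f) <= M%:E * Xnorm g1 g2 rho f)%E).

Definition spectrum (g1 g2 : R -> R) (L : R) (rho : (R -> \bar R) -> \bar R)
    (A : Op) : set R[i] :=
  [set lam | ~ exists S : Op, bounded_op g1 g2 L rho S /\
     (forall f, inX g1 g2 L rho f ->
        Xeq g1 g2 L (fun t => A (S f) t - lam * S f t) f) /\
     (forall f, inX g1 g2 L rho f ->
        Xeq g1 g2 L (S (fun t => A f t - lam * f t)) f)].

Definition spectral_radius (g1 g2 : R -> R) (L : R) (rho : (R -> \bar R) -> \bar R)
    (A : Op) : \bar R :=
  ereal_sup [set (Normc.normc lam)%:E | lam in spectrum g1 g2 L rho A].

Definition gW (g : R * R -> R[i]) (alpha : R * R -> R * R) : Op :=
  fun f t => g t * f (alpha t).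

End Defs.

(* Main.v *)
(* Let a be a lift of alpha to the arclength parameter, normalised to have a
   fixed point, and let |lam| exceed the right-hand side. Iterating,
   |(gW)^n f| (s) = G_n(s) |f| (a^n s), where G_n(s) is the product of |g| along
   the orbit of s. On a set where (a^n)' >= e^j, composition with a^n changes the
   distribution function by a factor at most e^-j; comparing decreasing
   rearrangements, it costs at most h_X(e^-j) in norm, hence up to a constant at
   most H(e^-j), where H(x) = max(x^(alpha_X - eps), x^(beta_X + eps)). Since H is
   submultiplicative, G_n(s) H(1 / (a^n)'(s)) is at most the product of
   w = |g| H(1 / a') along the orbit. An orbit is monotone between fixed points, so
   it makes boundedly many steps in the region where w >= q, for q slightly larger
   than the maximum of w over the fixed points; the product is O(q^n). Splitting the
   circle into the O(n) sets e^j <= (a^n)' < e^(j+1) gives ||(gW)^n|| = O(n q^n),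
   and the Neumann series for the inverse of gW - lam converges. *)
Require Import Defs.
From HB Require Import structures.
From mathcomp Require Import all_boot all_order all_algebra.
From mathcomp Require Import complex.
From mathcomp Require Import all_classical all_reals all_analysis measurable_realfun.
From mathcomp Require Import ring lra.
Set Implicit Arguments.
Unset Strict Implicit.
Unset Printing Implicit Defensive.
Import Order.TTheory GRing.Theory Num.Theory.
Import numFieldNormedType.Exports.
Local Open Scope classical_set_scope.
Local Open Scope ring_scope.

(** * Decreasing rearrangements and dilations *)

Section Rearrangement.
Variables (R : realType) (L : R).
Hypothesis L0 : 0 < L.
Local Notation mu := (@lebesgue_measure R).
Local Notation D := (`[0, L[%classic : set R).

Definition distr (f : R -> \bar R) (y : R) : \bar R :=
  mu (D `&` [set s | (y%:E < f s)%E]).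

(** The decreasing rearrangement of [f]. Adjoining 0 to the set of levels makes the supremum 0
    instead of -oo where no level qualifies. *)
Definition rearr (f : R -> \bar R) (s : R) : \bar R :=
  ereal_sup (0%E |` [set y%:E | y in [set y | 0 <= y /\ (s%:E < distr f y)%E]]).

Lemma measurable_superlevel f (y : R) : nonneg_meas D f ->
  measurable (D `&` [set s | (y%:E < f s)%E]).
Proof. by move=> [mf _]; apply: emeasurable_fun_o_infty => //; exact: mf. Qed.

Lemma lebesgue_measure_co0 (x : R) : 0 <= x -> mu `[0, x[%classic = x%:E.
Proof.
move=> x0; rewrite lebesgue_measure_itv/= lte_fin sube0.
by case: ltgtP x0 => // <-.
Qed.

Lemma distr_le_length f y : nonneg_meas D f -> (distr f y <= L%:E)%E.
Proof.
move=> nf; rewrite -(@lebesgue_measure_co0 L (ltW L0)).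
by rewrite /distr; apply: le_measure; rewrite ?inE//; exact: measurable_superlevel.
Qed.

Lemma distr_ge0 f y : (0 <= distr f y)%E.
Proof. exact: measure_ge0. Qed.

Lemma distr_neg f (y : R) : nonneg_meas D f -> y < 0 -> distr f y = L%:E.
Proof.
move=> [_ f0] y0; rewrite -(@lebesgue_measure_co0 L (ltW L0)) /distr.
congr (mu _); apply/seteqP; split => [s []//|s Ds]; split => //=.
by apply: lt_le_trans (f0 s); rewrite lte_fin.
Qed.

Lemma le_distr f (y z : R) : nonneg_meas D f -> y <= z -> (distr f z <= distr f y)%E.
Proof.
move=> nf yz; rewrite /distr; apply: le_measure; rewrite ?inE; try exact: measurable_superlevel.
by move=> s /= [Ds zs]; split => //; apply: le_lt_trans zs; rewrite lee_fin.
Qed.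

(** Continuity of the measure from below: the superlevel sets at [y + 1 / (n + 1)] increase to the
    one at [y]. *)
Lemma distr_right_continuous f (y : R) (s : \bar R) : nonneg_meas D f ->
  (s < distr f y)%E -> exists2 z, y < z & (s < distr f z)%E.
Proof.
move=> nf; apply: contraPP => /forall2NP H; apply/negP; rewrite -leNgt.
pose F n := D `&` [set t | ((y + n.+1%:R^-1)%:E < f t)%E].
have mF n : measurable (F n) by exact: measurable_superlevel.
have FE : \bigcup_n F n = D `&` [set t | (y%:E < f t)%E].
  apply/seteqP; split => [t [n _ [Dt /= ft]]|t [Dt /= ft]].
    split => //=; apply: lt_trans ft.
    by rewrite lte_fin ltrDl invr_gt0 ltr0n.
  have [n fn] : exists n, ((y + n.+1%:R^-1)%:E < f t)%E.
    case: (f t) ft => [r| |] //=.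
      rewrite lte_fin -subr_gt0 => yr.
      have [n] := near_infty_natSinv_lt (PosNum yr).
      by move=> _ /(_ n (leqnn n))/= h; exists n; rewrite lte_fin -ltrBrDl.
    by exists 0%N; rewrite ltry.
  by exists n.
rewrite /distr -FE.
have := @nondecreasing_cvg_mu _ _ _ mu F mF (bigcupT_measurable _ mF).
have ndF : nondecreasing_seq F.
  move=> m n mn; apply/subsetPset => t [Dt /= Ft]; split => //=.
  apply: le_lt_trans Ft; rewrite lee_fin lerD2l lef_pV2 ?posrE//.
  by rewrite ler_nat.
move=> /(_ ndF) cvF; apply: (cvge_to_le cvF); apply: nearW => n /=.
have [/negP|/negP] := H (y + n.+1%:R^-1); last by rewrite -leNgt.
by rewrite ltrDl invr_gt0 ltr0n.
Qed.

(** Right continuity of [distr] is what makes this an equivalence with strict inequalities on both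
    sides. All later facts on [rearr] are read off from it. *)
Lemma rearr_gt f (y s : R) : nonneg_meas D f -> 0 <= y ->
  (y%:E < rearr f s)%E = (s%:E < distr f y)%E.
Proof.
move=> nf y0; apply/idP/idP => [/ereal_sup_gt[z []]|].
- by move=> -> ; rewrite lte_fin ltNge y0.
- move=> {z} [z [z0 sz] <-]; rewrite lte_fin => yz.
  by apply: (lt_le_trans sz); apply: le_distr => //; exact: ltW.
- move=> /(distr_right_continuous nf)[z yz sz].
  apply: (@lt_le_trans _ _ z%:E); first by rewrite lte_fin.
  by apply: ereal_sup_ubound; right; exists z => //; split => //; lra.
Qed.

Lemma rearr_ge0 f s : (0 <= rearr f s)%E.
Proof. by apply: ereal_sup_ubound; left. Qed.

Lemma measurable_rearr f : nonneg_meas D f -> measurable_fun setT (rearr f).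
Proof.
move=> nf; apply: (measurability _ (ErealGenOInfty.measurableE R)).
move=> /= _ [_ [a ->]] <-; rewrite setTI.
have [a0|a0] := leP 0 a; last first.
  rewrite (_ : _ @^-1` _ = setT)//; apply/seteqP; split => // s _.
  rewrite /= in_itv/= andbT.
  by apply: lt_le_trans (rearr_ge0 f s); rewrite lte_fin.
(* By [rearr_gt] the superlevel sets are closed downwards, hence intervals. *)
apply: is_interval_measurable => x y /=.
rewrite !in_itv/= !andbT !rearr_gt// => xd yd z /andP[_ zy].
rewrite in_itv/= andbT rearr_gt//.
by apply: le_lt_trans yd; rewrite lee_fin.
Qed.

Lemma nonneg_meas_rearr f E : nonneg_meas D f -> nonneg_meas E (rearr f).
Proof.
move=> nf; split; last by move=> s; exact: rearr_ge0.
by apply: measurable_funTS; exact: measurable_rearr.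
Qed.

(** For [y >= 0] the part of [[0, L[] where [rearr f] exceeds [y] is the interval from 0 to
    [distr f y]. *)
Lemma distr_rearr f (y : R) : nonneg_meas D f -> distr (rearr f) y = distr f y.
Proof.
move=> nf; have [y0|y0] := leP 0 y; last first.
  by rewrite !distr_neg//; exact: nonneg_meas_rearr.
have dL := distr_le_length y nf.
have dfin : distr f y \is a fin_num.
  rewrite ge0_fin_numE ?distr_ge0//.
  by apply: (le_lt_trans dL); rewrite ltry.
rewrite {1}/distr (_ : _ `&` _ = `[0, (fine (distr f y))[%classic).
  by rewrite lebesgue_measure_co0 ?fineK// fine_ge0 ?distr_ge0.
rewrite -(fineK dfin) lee_fin in dL.
apply/seteqP; split => s /=; rewrite !in_itv/= rearr_gt//.
  by move=> [/andP[-> _]]; rewrite -{1}(fineK dfin) lte_fin.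
move=> /andP[-> sd]; split; first by apply: lt_le_trans dL.
by rewrite -(fineK dfin) lte_fin.
Qed.

Variables (rho : (R -> \bar R) -> \bar R).
Hypothesis bfn : banach_function_norm D rho.
Hypothesis ri : rearrangement_invariant D rho.

Lemma rho_rearr f : nonneg_meas D f -> rho (rearr f) = rho f.
Proof.
move=> nf; apply: ri => //; first exact: nonneg_meas_rearr.
by move=> y; have := distr_rearr y nf.
Qed.

Lemma nonneg_meas_dilation (f : R -> \bar R) (x : R) : 0 < x -> measurable_fun setT f ->
  (forall s, (0 <= f s)%E) -> nonneg_meas D (dilation L x f).
Proof.
move=> x0 mf f0; split; last by move=> s; rewrite /dilation; case: ifP.
apply: measurable_funTS; apply: measurable_fun_ifT => //.
- apply: measurable_and; apply: measurable_fun_ler => //; exact: mulrl_measurable.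
- by apply: (measurableT_comp mf); exact: mulrl_measurable.
Qed.

(** A level [y] below [rearr phi s] satisfies [s < x * distr f y], that is, it lies below
    [rearr f (s / x)]. The level [y = rearr f (s / x)] itself would therefore be contradictory. *)
Lemma rearr_le_dilation phi f (x s : R) : nonneg_meas D f -> nonneg_meas D phi ->
  0 < x -> 0 <= s ->
  (forall y : R, 0 <= y -> (distr phi y <= x%:E * distr f y)%E) ->
  (rearr phi s <= dilation L x^-1 (rearr f) s)%E.
Proof.
move=> nf np x0 s0 pf.
have [p0|] := leP (rearr phi s) 0%E.
  apply: (le_trans p0); rewrite /dilation; case: ifP => // _; exact: rearr_ge0.
move=> rp.
have key (y : R) : 0 <= y -> (y%:E < rearr phi s)%E ->
    ((x^-1 * s)%:E < distr f y)%E.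
  move=> y0; rewrite rearr_gt// => /lt_le_trans/(_ (pf y y0)).
  have dL := distr_le_length y nf.
  have dfin : distr f y \is a fin_num.
    rewrite ge0_fin_numE ?distr_ge0//.
    by apply: (le_lt_trans dL); rewrite ltry.
  rewrite -(fineK dfin) -EFinM !lte_fin.
  by rewrite ltr_pdivrMl.
(* The cut-off in [dilation] does no harm: where [rearr phi s] is positive,
   [s / x < distr f 0 <= L]. *)
have xs : (0 <= x^-1 * s) && (x^-1 * s <= L).
  rewrite mulr_ge0 ?invr_ge0 ?(ltW x0)//=.
  by have := lt_le_trans (key 0 (lexx _) rp) (distr_le_length 0 nf); rewrite lte_fin => /ltW.
rewrite /dilation xs; rewrite leNgt; apply/negP => lt.
have rf0 := rearr_ge0 f (x^-1 * s).
have : rearr f (x^-1 * s) \is a fin_num.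
  by rewrite ge0_fin_numE//; apply: (lt_le_trans lt); rewrite leey.
move=> /fineK rE; rewrite -rE in lt rf0.
have := key _ rf0 lt; rewrite -rearr_gt//.
by rewrite rE ltxx.
Qed.

(** Rearrangement invariance replaces both functions by their rearrangements, which the previous
    lemma compares pointwise through a dilation. *)
Lemma rho_le_dilation_norm phi f (x h r : R) :
  nonneg_meas D f -> nonneg_meas D phi -> 0 < x ->
  dilation_norm L rho x = h%:E -> rho f = r%:E ->
  (forall y : R, 0 <= y -> (distr phi y <= x%:E * distr f y)%E) ->
  (rho phi <= (h * r)%:E)%E.
Proof.
move=> nf np x0 hE rE pf.
have [Bge0 [B0 [BZ [BD [Bmono _]]]]] := bfn.
have nrf := nonneg_meas_rearr D nf.
have ndil f' : nonneg_meas D f' -> nonneg_meas D (dilation L x^-1 (rearr f')).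
  move=> nf'; apply: nonneg_meas_dilation; rewrite ?invr_gt0//.
    exact: measurable_rearr.
  exact: rearr_ge0.
have r0 : 0 <= r by rewrite -lee_fin -rE; exact: Bge0.
(* The norm [r] may vanish, so [rearr f] is scaled into the unit ball by some [c > r], and [c] tends
   to [r] at the end. *)
have dil_le c : r < c -> (rho phi <= (c * h)%:E)%E.
  move=> rc; have c0 : 0 < c by exact: le_lt_trans rc.
  rewrite -(rho_rearr np).
  apply: (@le_trans _ _ (rho (dilation L x^-1 (rearr f)))).
    apply: Bmono; [exact: ndil|exact: nonneg_meas_rearr|].
    apply: aeW => s /=; rewrite in_itv/= => /andP[s0 _].
    exact: rearr_le_dilation.
  have -> : dilation L x^-1 (rearr f) = (fun s => c%:E *
      dilation L x^-1 (fun s => (c^-1)%:E * rearr f s) s)%E.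
    apply/funext => s; rewrite /dilation; case: ifP; rewrite ?mule0// => _.
    by rewrite muleA -EFinM divff ?mul1e// gt_eqF.
  have nc E : nonneg_meas E (fun s => (c^-1)%:E * rearr f s)%E.
    split; last by move=> s; rewrite mule_ge0 ?rearr_ge0// lee_fin invr_ge0 ltW.
    apply: measurable_funTS; apply: emeasurable_funM => //.
    exact: measurable_rearr.
  rewrite BZ ?(ltW c0)//; last first.
    apply: nonneg_meas_dilation; rewrite ?invr_gt0//; last by case: (nc setT).
    by case: (nc setT).
  rewrite EFinM lee_pmul2l ?lte_fin// -hE; apply: ereal_sup_ubound.
  exists (fun s => (c^-1)%:E * rearr f s)%E => //; split => //.
  rewrite BZ//; last by rewrite invr_ge0 ltW.
  rewrite rho_rearr// rE -EFinM lee_fin mulrC ler_pdivrMr// mul1r; exact: ltW.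
have h0 : 0 <= h.
  have := dil_le (r + 1); rewrite ltrDl ltr01 => /(_ isT).
  move=> /(le_trans (Bge0 _ np)); rewrite lee_fin pmulr_rge0//.
  by rewrite ltr_wpDl.
(* The choice is [c = r + e / (h + 1)]; the summand 1 covers [h = 0]. *)
apply/lee_addgt0Pr => e e0.
apply: (@le_trans _ _ ((r + e / (h + 1)) * h)%:E).
  by apply: dil_le; rewrite ltrDl divr_gt0// ltr_wpDl.
rewrite -EFinD lee_fin mulrDl mulrC lerD2l mulrAC ler_pdivrMr ?ltr_wpDl//.
by rewrite ler_pM2l// lerDl.
Qed.

End Rearrangement.

(** * Lifts of circle diffeomorphisms and change of variables *)

Section CircleLift.
Variable R : realType.
Local Notation mu := (@lebesgue_measure R).

Definition circle_lift (L : R) (a : R -> R) : Prop :=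
  [/\ forall s, a (s + L) = a s + L, forall s, derivable a s 1,
      continuous (derive1 a) & forall s, 0 < derive1 a s].

Section Lift.
Variables (L : R) (a : R -> R).
Hypotheses (L0 : 0 < L) (la : circle_lift L a).

Lemma lift_continuous : continuous a.
Proof.
case: la => _ da _ _ s; exact/differentiable_continuous/derivable1_diffP.
Qed.

Lemma lift_homo : {homo a : x y / x < y}.
Proof.
case: la => _ da _ a0 x y xy.
apply: (@gtr0_derive1_lt_cc _ a x y) => //; rewrite ?in_itv/= ?lexx ?ltW//.
exact: continuous_subspaceT lift_continuous.
Qed.

Lemma lift_lemono : {mono a : x y / x <= y}.
Proof. exact: le_mono lift_homo. Qed.

Lemma lift_mono : {mono a : x y / x < y}.
Proof. exact: leW_mono lift_lemono. Qed.

Lemma liftDn n s : a (s + L *+ n) = a s + L *+ n.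
Proof.
case: la => aL _ _ _.
elim: n => [|n IH]; first by rewrite mulr0n !addr0.
by rewrite !mulrSr !addrA aL IH.
Qed.

Lemma liftDz (k : int) s : a (s + L *~ k) = a s + L *~ k.
Proof.
case: k => n; first exact: liftDn.
rewrite NegzE mulrNz; apply/eqP; rewrite -subr_eq opprK eq_sym; apply/eqP.
by rewrite -liftDn addrNK.
Qed.

(** The values [a 0 - L *+ n] and [a 0 + L *+ n] enclose [y] for large [n], and the intermediate
    value theorem applies. *)
Lemma lift_surj y : exists s, a s = y.
Proof.
have [n hn] : exists n, `|y - a 0| <= L *+ n.
  exists (Num.bound (`|y - a 0| / L)).
  have := archi_boundP (divr_ge0 (normr_ge0 (y - a 0)) (ltW L0)).
  by rewrite ltr_pdivrMr// -[X in _ -> _ <= X]mulr_natl => /ltW.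
have h1 : a (0 - L *+ n) <= y.
  have := liftDn n (0 - L *+ n); rewrite subrK => e.
  by move: hn; rewrite ler_norml => /andP[]; lra.
have h2 : y <= a (0 + L *+ n).
  by rewrite liftDn; move: hn; rewrite ler_norml => /andP[]; lra.
have Ln0 : 0 - L *+ n <= 0 + L *+ n.
  by have := mulrn_wge0 n (ltW L0); lra.
have [c _ <-] : exists2 c, c \in `[0 - L *+ n, 0 + L *+ n] & a c = y.
  apply: IVT => //; first exact: continuous_subspaceT lift_continuous.
  by rewrite ge_min le_max h1 h2 orbT.
by exists c.
Qed.

(** The image under [a] of the measure with density [a']. It is declared as a measure below so that
    uniqueness of Lebesgue measure can be applied to it. *)
Definition density_pushforward (B : set (measurableTypeR R)) : \bar R :=
  (\int[mu]_(s in a @^-1` B) (derive1 a s)%:E)%E.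

Lemma measurable_derive1_lift E :
  measurable_fun E (fun s => (derive1 a s)%:E).
Proof.
case: la => _ _ ca _; apply: measurable_funTS; apply/measurable_EFinP.
exact: continuous_measurable_fun.
Qed.

Lemma measurable_lift : measurable_fun setT a.
Proof. by apply: continuous_measurable_fun; exact: lift_continuous. Qed.

Lemma measurable_preimage_lift B : measurable B -> measurable (a @^-1` B).
Proof. by move=> mB; rewrite -[_ @^-1` _]setTI; exact: measurable_lift. Qed.

Let density0 : density_pushforward set0 = 0%E.
Proof. by rewrite /density_pushforward preimage_set0 integral_set0. Qed.

Let density_ge0 B : (0 <= density_pushforward B)%E.
Proof.
by case: la => _ _ _ a0; apply: integral_ge0 => s _; rewrite lee_fin ltW.
Qed.

Let density_additive : semi_sigma_additive density_pushforward.
Proof.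
case: la => _ _ _ a0 /= A mA tA mUA.
rewrite /density_pushforward preimage_bigcup ge0_integral_bigcup//=.
- apply: is_cvg_ereal_nneg_natsum_cond => n _ _.
  by apply: integral_ge0 => s _; rewrite lee_fin ltW.
- by move=> k; exact: (measurable_preimage_lift (mA k)).
- exact: measurable_derive1_lift.
- by move=> s _; rewrite lee_fin ltW.
- by move=> i j _ _ [s [Ai Aj]]; apply: tA => //; exists (a s).
Qed.

HB.instance Definition _ := isMeasure.Build _ _ _
  density_pushforward density0 density_ge0 density_additive.

(** Change of variables: by uniqueness it suffices to test half-open intervals, where the
    fundamental theorem of calculus for [a] gives the length. *)
Lemma density_pushforwardE B : measurable B -> density_pushforward B = mu B.
Proof.
case: (la) => aL da ca a0 mB.
apply/esym; apply: lebesgue_measure_unique => //.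
move=> _ [[u v] _ <-] /=; rewrite /density_pushforward.
have [u' u'E] := lift_surj u; have [v' v'E] := lift_surj v.
have -> : a @^-1` `]u, v]%classic = `]u', v']%classic.
  apply/seteqP; split => s /=; rewrite !in_itv/= -u'E -v'E.
    by rewrite lift_mono lift_lemono.
  by rewrite lift_mono lift_lemono.
rewrite lebesgue_measure_itv/= lte_fin -u'E -v'E lift_mono.
case: ltP => [uv|vu]; last by rewrite set_itv_ge ?integral_set0// bnd_simp -leNgt.
rewrite integral_itv_obnd_cbnd; last exact: measurable_derive1_lift.
apply/esym; apply: (continuous_FTC2 uv).
- exact: continuous_subspaceT.
- split; first by move=> ? _; exact: da.
    by apply: cvg_at_right_filter; exact: lift_continuous.
  by apply: cvg_at_left_filter; exact: lift_continuous.
- by move=> s _.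
Qed.

(* [mu B] is the integral of [a'] over the preimage of [B]. *)
Lemma measure_preimage_lift_le E B (m : R) : measurable E -> measurable B ->
  (forall s, E s -> m <= derive1 a s) -> 0 <= m ->
  (m%:E * mu (E `&` a @^-1` B) <= mu B)%E.
Proof.
move=> mE mB mle m0; case: (la) => aL da ca a0.
have mEB : measurable (E `&` a @^-1` B).
  by apply: measurableI => //; exact: measurable_preimage_lift.
rewrite -[leRHS]density_pushforwardE// /density_pushforward -integral_cst//.
apply: (@le_trans _ _ (\int[mu]_(s in E `&` a @^-1` B) (derive1 a s)%:E)%E).
  apply: ge0_le_integral => //.
  - exact: measurable_derive1_lift.
  - by move=> s [/mle h _]; rewrite lee_fin.
apply: ge0_subset_integral => //.
- exact: measurable_preimage_lift.
- exact: measurable_derive1_lift.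
- by move=> s _; rewrite lee_fin ltW.
Qed.

End Lift.

Lemma circle_lift_id L : circle_lift L id.
Proof.
split => //.
- rewrite (_ : derive1 id = cst 1); first exact: cst_continuous.
  by apply/funext => s; rewrite derive1_id.
- by move=> s; rewrite derive1_id ltr01.
Qed.

Lemma derive1_lift_comp L a b s : circle_lift L a -> circle_lift L b ->
  derive1 (a \o b) s = derive1 a (b s) * derive1 b s.
Proof. by move=> [_ da _ _] [_ db _ _]; rewrite derive1_comp. Qed.

Lemma circle_lift_comp L a b : circle_lift L a -> circle_lift L b ->
  circle_lift L (a \o b).
Proof.
move=> la lb; have cb := lift_continuous lb.
have dE : derive1 (a \o b) = (fun s => derive1 a (b s) * derive1 b s).
  by apply/funext => s; exact: derive1_lift_comp la lb.
case: la lb => aL da ca a0 [bL db cb' b0]; split.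
- by move=> s /=; rewrite bL aL.
- move=> s; apply/derivable1_diffP; apply: differentiable_comp; exact/derivable1_diffP.
- rewrite dE => s; apply: cvgM; last exact: cb'.
  exact: (cvg_comp _ _ (cb s) (ca (b s))).
- by move=> s; rewrite dE mulr_gt0.
Qed.

Lemma circle_lift_iter L a n : circle_lift L a -> circle_lift L (iter n a).
Proof.
move=> la; elim: n => [|n IH]; first exact: circle_lift_id.
by have := circle_lift_comp la IH.
Qed.

Lemma derive1_lift_iter L a n s : circle_lift L a ->
  derive1 (iter n a) s = \prod_(k < n) derive1 a (iter k a s).
Proof.
move=> la; elim: n => [|n IH]; first by rewrite big_ord0 derive1_id.
rewrite big_ord_recr/= mulrC -IH.
by have := derive1_lift_comp s la (circle_lift_iter n la).
Qed.

(** * Periodic functions and fundamental domains *)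

Section Periodic.
Variables (L : R) (L0 : 0 < L).
Local Notation D := (`[0, L[%classic : set R).

Lemma periodicDz (T : Type) (F : R -> T) (k : int) s :
  (forall s, F (s + L) = F s) -> F (s + L *~ k) = F s.
Proof.
move=> FL; have Fn n t : F (t + L *+ n) = F t.
  elim: n => [|n IH]; first by rewrite mulr0n addr0.
  by rewrite mulrSr addrA FL.
case: k => n; first exact: Fn.
by have := Fn n.+1 (s - L *+ n.+1); rewrite subrK NegzE mulrNz.
Qed.

Lemma exists_shift (c s : R) : exists k : int, c <= s + L *~ k < c + L.
Proof.
exists (- Num.floor ((s - c) / L)).
have /andP[h1 h2] := mem_rg1_floor ((s - c) / L).
rewrite mulrNz -mulrzl; move: h1 h2; rewrite ler_pdivlMr// ltr_pdivrMr//.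
by move=> h1 h2; apply/andP; split; lra.
Qed.

Lemma measurable_preimage_shift (B : set R) (c : R) : measurable B ->
  measurable ((fun s => s + c) @^-1` B).
Proof.
have mc : measurable_fun setT (fun s : R => s + c) by exact: measurable_funD.
by move=> mB; rewrite -[X in measurable X]setTI; exact: mc.
Qed.

(** A translation is a circle lift with derivative 1, so this is an instance of the change of
    variables. *)
Lemma measure_shift (B : set R) (c : R) : measurable B ->
  mu ((fun s => s + c) @^-1` B) = mu B.
Proof.
move=> mB; have dE : derive1 (fun s : R => s + c) = cst 1.
  by apply/funext => s; rewrite derive1E deriveD// derive_id derive_cst addr0.
have lc : circle_lift L (fun s => s + c).
  split; [by move=> s; ring|by move=> s; exact: derivableD| |].
  - by rewrite dE; exact: cst_continuous.
  - by move=> s; rewrite dE ltr01.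
have := density_pushforwardE L0 lc mB.
rewrite /density_pushforward dE => <-.
rewrite (@integral_cst _ _ _ mu _ _ 1) ?mul1e//.
exact: measurable_preimage_shift mB.
Qed.

(** The two domains share [[c, L[]; the remaining pieces [[L, c + L[] and [[0, c[] are translates of
    each other by [L]. *)
Lemma measure_period (P : set R) (c : R) : measurable P ->
  (forall s, P (s + L) = P s) -> 0 <= c < L ->
  mu (`[c, c + L[%classic `&` P) = mu (D `&` P).
Proof.
move=> mP PL /andP[c0 cL].
have -> : `[c, c + L[%classic `&` P =
    (`[c, L[%classic `&` P) `|` (`[L, c + L[%classic `&` P).
  rewrite -setIUl; congr (_ `&` _); apply/seteqP; split => s /=; rewrite !in_itv/=.
    by move=> /andP[h1 h2]; have [h|h] := ltP s L; [left|right]; apply/andP; split; lra.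
  by move=> [|] /andP[h1 h2]; apply/andP; split; lra.
have -> : D `&` P = (`[c, L[%classic `&` P) `|` (`[0, c[%classic `&` P).
  rewrite -setIUl; congr (_ `&` _); apply/seteqP; split => s /=; rewrite !in_itv/=.
    by move=> /andP[h1 h2]; have [h|h] := ltP s c; [right|left]; apply/andP; split; lra.
  by move=> [|] /andP[h1 h2]; apply/andP; split; lra.
have mI (i : interval R) : measurable ([set` i] `&` P) by exact: measurableI.
rewrite !measureU; try exact: mI.
- congr (_ + _)%E; transitivity (mu ((fun s => s + L) @^-1` (`[L, c + L[%classic `&` P))).
    by rewrite measure_shift.
  congr (mu _); apply/seteqP; split => s /=; rewrite !in_itv/= PL => -[/andP[h1 h2] p];
    by split => //; apply/andP; split; lra.
- apply/seteqP; split => s //= [[+ _] [+ _]]; rewrite !in_itv/= => /andP[h1 h2] /andP[h3 h4]; lra.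
- apply/seteqP; split => s //= [[+ _] [+ _]]; rewrite !in_itv/= => /andP[h1 h2] /andP[h3 h4]; lra.
Qed.

(** A preimage under [F] is the countable union of the translates, by multiples of [L], of its part
    in [[0, L[]. *)
Lemma measurable_periodic d (T : measurableType d) (F : R -> T) :
  (forall s, F (s + L) = F s) -> measurable_fun D F -> measurable_fun setT F.
Proof.
move=> FL mF _ Y mY; rewrite setTI.
have mDY : measurable (D `&` F @^-1` Y) by exact: mF.
have -> : F @^-1` Y =
    \bigcup_n ((fun s => s + L *+ n) @^-1` (D `&` F @^-1` Y)) `|`
    \bigcup_n ((fun s => s - L *+ n) @^-1` (D `&` F @^-1` Y)).
  apply/seteqP; split => s /=.
    move=> Ys; have [k] := exists_shift 0 s.
    rewrite add0r => kD; case: k kD => n kD; [left|right].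
      exists n => //=; split; first by rewrite in_itv.
      by have := periodicDz n s FL => /= ->.
    exists n.+1 => //=; split; first by rewrite in_itv/=; move: kD; rewrite NegzE mulrNz.
    by have := periodicDz (- n.+1%:Z) s FL; rewrite mulrNz => /= ->.
  move=> [[n _ /= [_]]|[n _ /= [_]]].
    by have := periodicDz n s FL => /= ->.
  by have := periodicDz (- n%:Z) s FL; rewrite mulrNz => /= ->.
by apply: measurableU; apply: bigcupT_measurable => n;
  exact: measurable_preimage_shift.
Qed.

(** The lift [b] maps [[0, L[] onto one full period starting at [b 0], on which [F] has the same
    distribution function as on [[0, L[]. A derivative of at least [m] on [E] then shrinks measure
    by the factor [m]. *)
Lemma measure_superlevel_comp_lift b (F : R -> \bar R) (E : set R) (m y : R) :
  circle_lift L b -> measurable E -> measurable_fun setT F ->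
  (forall s, F (s + L) = F s) -> 0 <= m -> (forall s, E s -> m <= derive1 b s) ->
  (m%:E * mu (D `&` (E `&` [set s | (y%:E < F (b s))%E])) <=
   mu (D `&` [set s | (y%:E < F s)%E]))%E.
Proof.
move=> lb mE mF FL m0 mb.
have [k] := exists_shift 0 (b 0); rewrite add0r => ck.
pose P := [set s | (y%:E < F s)%E].
have mP : measurable P.
  by rewrite -[P]setTI; apply: emeasurable_fun_o_infty => //; exact: mF.
have PL s : P (s + L) = P s by rewrite /P /= FL.
rewrite -(@measure_period P (b 0 + L *~ k))//.
have -> : D `&` (E `&` [set s | (y%:E < F (b s))%E]) =
    (D `&` E) `&` b @^-1` ((fun s => s + L *~ k) @^-1`
      (`[b 0 + L *~ k, b 0 + L *~ k + L[%classic `&` P)).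
  rewrite setIA; apply/seteqP; split => s /= [[Ds Es] h]; split => //.
    move: Ds; rewrite !in_itv/= /P/= (@periodicDz _ F)// => /andP[h1 h2].
    split => //; rewrite lerD2r (lift_lemono lb)// h1/= addrAC ltrD2r.
    by case: (lb) => bL _ _ _; rewrite -bL (lift_mono lb)// add0r.
  by move: h => [_]; rewrite /P/= (@periodicDz _ F).
rewrite -(@measure_shift (_ `&` P) (L *~ k)); last by exact: measurableI.
apply: (measure_preimage_lift_le L0 lb) => //.
- exact: measurableI.
- by apply: measurable_preimage_shift; exact: measurableI.
- by move=> s [_ /mb].
Qed.

End Periodic.
End CircleLift.

(** * Orbits between fixed points *)

Section Orbit.
Variables (R : realType) (L : R) (a : R -> R).
Hypotheses (L0 : 0 < L) (la : circle_lift L a).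

(** Two translates of the fixed point, at distance [2 L], bound an invariant interval containing
    [[0, L]]. It provides the compactness for orbits starting in a fundamental domain. *)
Lemma lift_invariant_interval s0 : a s0 = s0 ->
  exists u v : R, [/\ u <= 0, L <= v, a u = u & a v = v].
Proof.
move=> as0; have [k /andP[k1 k2]] := exists_shift L0 (- L) s0.
exists (s0 + L *~ k), (s0 + L *~ k + L *+ 2).
rewrite (liftDn la)// (liftDz la)// as0; split => //; lra.
Qed.

Variables (u v : R).
Hypotheses (uv : u <= v) (au : a u = u) (av : a v = v).

Lemma iter_lift_itv n s : u <= s <= v -> u <= iter n a s <= v.
Proof.
elim: n => //= n IH /IH/andP[h1 h2].
by rewrite -{1}au -{1}av !(lift_lemono la)// h1.
Qed.

(** Since [a] is increasing, the sign of [a s - s] persists along the orbit; the sum telescopes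
    inside the invariant interval. *)
Lemma lift_total_variation n s : u <= s <= v ->
  \sum_(k < n) `|a (iter k a s) - iter k a s| <= v - u.
Proof.
move=> suv.
have [as_le|as_ge] := leP (a s) s.
- have dec k : a (iter k a s) <= iter k a s.
    by elim: k => //= k IH; rewrite (lift_lemono la).
  have -> : \sum_(k < n) `|a (iter k a s) - iter k a s| = s - iter n a s.
    elim: n => [|n IH]; first by rewrite big_ord0 subrr.
    by rewrite big_ord_recr/= IH ler0_norm ?subr_le0//; ring.
  by have /andP[? ?] := iter_lift_itv n suv; case/andP: suv => ? ?; lra.
- have inc k : iter k a s <= a (iter k a s).
    by elim: k => [|k IH]; [exact: ltW|rewrite /= (lift_lemono la)].
  have -> : \sum_(k < n) `|a (iter k a s) - iter k a s| = iter n a s - s.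
    elim: n => [|n IH]; first by rewrite big_ord0 subrr.
    by rewrite big_ord_recr/= IH ger0_norm ?subr_ge0//; ring.
  by have /andP[? ?] := iter_lift_itv n suv; case/andP: suv => ? ?; lra.
Qed.

(* Away from the fixed points each step moves by a definite amount, while the
   whole orbit has bounded variation. *)
Lemma lift_orbit_prod (w : R -> R) (q : R) : continuous w ->
  (forall s, 0 <= w s) -> (forall s, a s = s -> w s < q) ->
  exists2 C : R, 0 < C & forall n s, u <= s <= v ->
    \prod_(k < n) w (iter k a s) <= C * q ^+ n.
Proof.
move=> cw w0 wq; have q0 : 0 < q by exact: le_lt_trans (w0 u) (wq u au).
have ca := lift_continuous la.
(* Where [w >= q] this is just the displacement [|a s - s|]. It is positive everywhere because
   [w < q] at fixed points, so its minimum [psi c] bounds from below the steps made where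
   [w >= q]. *)
pose psi (s : R) : R := `|q - w s| + (q - w s) + `|a s - s|.
have cpsi : continuous psi.
  have cqw : continuous (fun s => q - w s).
    by move=> s; apply: cvgB; [exact: cvg_cst|exact: cw].
  move=> s; apply: cvgD; first by apply: cvgD; [apply: cvg_norm|]; exact: cqw.
  by apply: cvg_norm; apply: cvgB; [exact: ca|exact: cvg_id].
have psi0 s : 0 < psi s.
  rewrite /psi; have := normr_ge0 (q - w s); have := ler_norm (- (q - w s)).
  rewrite normrN; have [as_|as_] := eqVneq (a s) s.
    by have := wq s as_; rewrite as_ subrr normr0; lra.
  have : 0 < `|a s - s| by rewrite normr_gt0 subr_eq0.
  lra.
have [c _ psic] := EVT_min uv (continuous_subspaceT (A := `[u, v]) cpsi).
have [d _ wd] := EVT_max uv (continuous_subspaceT (A := `[u, v]) cw).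
(* With this [K], a step of length at least [psi c] has [q * K * |a s - s| >= w d], the maximum of
   [w]. Each factor is thus at most [q] times an exponential, and the exponents add up to at most
   [K * (v - u)]. *)
pose K := w d / (q * psi c).
have K0 : 0 <= K by rewrite divr_ge0// mulr_ge0 ?ltW.
have wK s : u <= s <= v -> w s <= q * expR (K * `|a s - s|).
  move=> suv; have [wsq|wsq] := leP (w s) q.
    by apply: (le_trans wsq); rewrite ler_peMr ?(ltW q0)// -expR0 ler_expR mulr_ge0.
  apply: (@le_trans _ _ (q * (1 + K * `|a s - s|))); last first.
    by rewrite ler_pM2l// expR_ge1Dx.
  apply: (@le_trans _ _ (w d)); first by apply: wd; rewrite in_itv.
  have : psi c <= `|a s - s|.
    have := psic s; rewrite in_itv/= => /(_ suv)/le_trans; apply.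
    by rewrite /psi ler0_norm; lra.
  move=> h; rewrite mulrDr mulr1 ler_wpDl ?(ltW q0)// mulrA.
  have -> : q * K = w d / psi c by rewrite /K; field; rewrite !gt_eqF.
  by rewrite mulrAC ler_pdivlMr// ler_wpM2l.
exists (expR (K * (v - u))); first exact: expR_gt0.
move=> n s suv.
apply: (@le_trans _ _ (expR (K * \sum_(k < n) `|a (iter k a s) - iter k a s|) * q ^+ n)).
  elim: n => [|n IH]; first by rewrite !big_ord0 mulr0 expR0 mul1r expr0.
  rewrite !big_ord_recr/= mulrDr expRD exprSr mulrACA.
  apply: ler_pM => //; first by apply: prodr_ge0.
  by rewrite mulrC; apply: wK; exact: iter_lift_itv.
rewrite ler_pM2r ?exprn_gt0// ler_expR ler_wpM2l//.
exact: lift_total_variation.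
Qed.

Lemma ln_derive1_lift_bounded : exists2 B : R, 0 <= B &
  forall s, u <= s <= v -> `|ln (derive1 a s)| <= B.
Proof.
case: (la) => _ _ ca a0.
have cl : continuous (fun s => `|ln (derive1 a s)|).
  move=> s; apply: cvg_norm.
  exact: (continuous_comp (ca s) (continuous_ln (a0 s))).
have [d _ wd] := EVT_max uv (continuous_subspaceT (A := `[u, v]) cl).
exists `|ln (derive1 a d)|; first exact: normr_ge0.
by move=> s suv; apply: wd; rewrite in_itv.
Qed.

Lemma ln_derive1_iter n s :
  ln (derive1 (iter n a) s) = \sum_(k < n) ln (derive1 a (iter k a s)).
Proof.
case: (la) => _ _ _ a0; rewrite (derive1_lift_iter _ _ la)//.
elim: n => [|n IH]; first by rewrite !big_ord0 ln1.
rewrite !big_ord_recr/= lnM ?IH// posrE//.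
by apply: prodr_gt0.
Qed.

End Orbit.

(** * Boyd indices and the norm of weighted compositions *)

Section Boyd.
Variables (R : realType) (L : R) (rho : (R -> \bar R) -> \bar R).
Hypothesis L0 : 0 < L.
Local Notation mu := (@lebesgue_measure R).
Local Notation D := (`[0, L[%classic : set R).
Hypothesis bfn : banach_function_norm D rho.
Hypothesis ri : rearrangement_invariant D rho.

Lemma rho0 : rho (fun=> 0%E) = 0%E.
Proof.
case: bfn => _ [B0 _]; apply/B0; last by apply: aeW => s _.
by split => //; exact: measurable_cst.
Qed.

Lemma nonneg_meas_sum m (phi : nat -> R -> \bar R) :
  (forall j, nonneg_meas D (phi j)) ->
  nonneg_meas D (fun s => \sum_(j < m) phi j s)%E.
Proof.
move=> np; split; last by move=> s; apply: sume_ge0 => j _; case: (np j).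
by apply: emeasurable_sum => j; case: (np j).
Qed.

Lemma rho_sum_le m (phi : nat -> R -> \bar R) (K : nat -> R) :
  (forall j, nonneg_meas D (phi j)) ->
  (forall j, (j < m)%N -> (rho (phi j) <= (K j)%:E)%E) ->
  (rho (fun s => \sum_(j < m) phi j s) <= (\sum_(j < m) K j)%:E)%E.
Proof.
move=> np; have [_ [_ [_ [BD _]]]] := bfn.
elim: m => [|m IH] rK.
  rewrite (_ : (fun s => _) = fun=> 0%E) ?rho0 ?big_ord0//.
  by apply/funext => s; rewrite big_ord0.
rewrite (_ : (fun s => _) = fun s => (\sum_(j < m) phi j s + phi m s)%E); last first.
  by apply/funext => s; rewrite big_ord_recr.
apply: (le_trans (BD _ _ (nonneg_meas_sum _ np) (np m))).
rewrite big_ord_recr/= EFinD; apply: leeD; last exact: rK.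
by apply: IH => j jm; apply: rK; rewrite ltnS ltnW.
Qed.

Variables (hX : R -> R) (aX bX : R).
Hypothesis hXE : forall x : R, 0 < x -> (hX x)%:E = dilation_norm L rho x.
Hypothesis cvga : (fun x => ln (hX x) / ln x) @ 0^'+ --> aX.
Hypothesis cvgb : (fun x => ln (hX x) / ln x) @ +oo --> bX.

(** The submultiplicative function [max(x^p1, x^p2)] in the logarithmic variable [t = ln x]. *)
Definition boyd_majorant (p1 p2 t : R) : R := expR (Num.max (p1 * t) (p2 * t)).

Lemma boyd_majorantD p1 p2 t t' :
  boyd_majorant p1 p2 (t + t') <= boyd_majorant p1 p2 t * boyd_majorant p1 p2 t'.
Proof.
rewrite /boyd_majorant -expRD ler_expR ge_max !mulrDr.
by apply/andP; split; apply: lerD; rewrite le_max lexx ?orbT.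
Qed.

Lemma boyd_majorant_sum p1 p2 n (t : nat -> R) :
  boyd_majorant p1 p2 (\sum_(k < n) t k) <=
  \prod_(k < n) boyd_majorant p1 p2 (t k).
Proof.
elim: n => [|n IH].
  by rewrite !big_ord0 /boyd_majorant !mulr0 maxxx expR0.
rewrite !big_ord_recr/=; apply: (le_trans (boyd_majorantD _ _ _ _)).
by rewrite ler_pM2r ?expR_gt0.
Qed.

(** Allows the logarithm of a derivative to be rounded to a grid of step 1 at the cost of a
    constant. *)
Lemma boyd_majorant_lip p1 p2 t t' : `|t - t'| <= 1 ->
  boyd_majorant p1 p2 t <= expR (`|p1| + `|p2|) * boyd_majorant p1 p2 t'.
Proof.
move=> tt; have -> : t = (t - t') + t' by ring.
apply: (le_trans (boyd_majorantD _ _ _ _)).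
rewrite ler_pM2r ?expR_gt0// ler_expR ge_max.
have b (p : R) : p * (t - t') <= `|p|.
  apply: (le_trans (ler_norm _)); rewrite normrM -[leRHS]mulr1.
  by apply: ler_wpM2l.
apply/andP; split; apply: (le_trans (b _)).
  by rewrite lerDl.
by rewrite lerDr.
Qed.

(** The limits defining the indices control [hX (expR t)] only for large [|t|]. The bounded range of
    [t] between is absorbed into the constant. *)
Lemma rho_le_boyd_majorant (p1 p2 : R) : p1 < aX -> bX < p2 ->
  exists2 C : R, 0 < C & forall (t r : R) phi f,
    nonneg_meas D phi -> nonneg_meas D f -> rho f = r%:E ->
    (forall y : R, 0 <= y -> (distr L phi y <= (expR t)%:E * distr L f y)%E) ->
    (rho phi <= (C * boyd_majorant p1 p2 t * r)%:E)%E.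
Proof.
move=> p1a bp2; have Bge0 := bfn.1.
have hX_le (t r x : R) phi f : nonneg_meas D phi -> nonneg_meas D f ->
    rho f = r%:E -> t <= x ->
    (forall y : R, 0 <= y -> (distr L phi y <= (expR t)%:E * distr L f y)%E) ->
    (rho phi <= (hX (expR x) * r)%:E)%E.
  move=> np nf rE tx pf.
  apply: (@rho_le_dilation_norm R L L0 rho bfn ri phi f (expR x)) => //.
  - exact: expR_gt0.
  - by rewrite hXE ?expR_gt0.
  - move=> y y0; apply: (le_trans (pf y y0)); apply: lee_wpmul2r.
      exact: distr_ge0.
    by rewrite lee_fin ler_expR.
have [T [T0 Tlo Thi]] : exists T, [/\ 0 < T,
    forall t, t < - T -> hX (expR t) <= expR (p1 * t) &
    forall t, T < t -> hX (expR t) <= expR (p2 * t)].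
  have := cvgr_gt _ cvga _ p1a.
  move=> [e /= e0 near0].
  have [A [_ nearoo]] := cvgr_lt _ cvgb _ bp2.
  (* Then [t < - T] puts [expR t] below [e], and [t > T] puts it above [A]; the maximum with 1 keeps
     the logarithm meaningful. *)
  exists (`|ln e| + `|ln (Num.max A 1)| + 1); split.
  - by rewrite ltr_wpDl ?addr_ge0.
  - move=> t tT; have t0 : t < 0.
      by have := normr_ge0 (ln e); have := normr_ge0 (ln (Num.max A 1)); lra.
    (* A value of [hX] that is not positive satisfies the bound trivially; only a positive one is
       recovered from its logarithm. *)
    have [h0|h0] := leP (hX (expR t)) 0; first exact: (le_trans h0 (expR_ge0 _)).
    have : p1 < ln (hX (expR t)) / ln (expR t).
      apply: near0 => /=; last exact: expR_gt0.
      rewrite sub0r normrN gtr0_norm ?expR_gt0// -[ltRHS]lnK ?posrE// ltr_expR.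
      have := ler_norm (- ln e); rewrite normrN.
      by have := normr_ge0 (ln (Num.max A 1)); lra.
    rewrite expRK ltr_ndivlMr// => /ltW.
    by move=> h; rewrite -[leLHS]lnK ?posrE// ler_expR.
  - move=> t Tt; have t0 : 0 < t.
      by have := normr_ge0 (ln e); have := normr_ge0 (ln (Num.max A 1)); lra.
    have [h0|h0] := leP (hX (expR t)) 0; first exact: (le_trans h0 (expR_ge0 _)).
    have : ln (hX (expR t)) / ln (expR t) < p2.
      apply: nearoo => /=; apply: (@le_lt_trans _ _ (Num.max A 1)).
        by rewrite le_max lexx.
      rewrite -[ltLHS]lnK ?posrE ?lt_max ?ltr01 ?orbT// ltr_expR.
      have := ler_norm (ln (Num.max A 1)).
      by have := normr_ge0 (ln e); lra.
    rewrite expRK ltr_pdivrMr// => /ltW.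
    by move=> h; rewrite -[leLHS]lnK ?posrE// ler_expR.
(* For [|t| <= T] the majorant is at least [expR (- (|p1| * T))], so [C] times the majorant
   dominates [hX (expR T)]. *)
pose C := 1 + `|hX (expR T)| * expR (`|p1| * T).
have C1 : 1 <= C by rewrite /C lerDl mulr_ge0 ?expR_ge0.
exists C; first by apply: lt_le_trans C1.
move=> t r phi f np nf rE pf.
have r0 : 0 <= r by rewrite -lee_fin -rE; exact: Bge0.
(* Enlarging [t] only weakens the assumption on distribution functions, so [x = T] serves the whole
   middle range. *)
have [x [tx hx]] : exists x, t <= x /\ hX (expR x) <= C * boyd_majorant p1 p2 t.
  have [tT|tT] := ltP t (- T).
    exists t; split => //; apply: (le_trans (Tlo t tT)).
    rewrite -[leLHS]mul1r; apply: ler_pM => //; rewrite ?expR_ge0//.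
    by rewrite ler_expR le_max lexx.
  have [Tt|Tt] := ltP T t.
    exists t; split => //; apply: (le_trans (Thi t Tt)).
    rewrite -[leLHS]mul1r; apply: ler_pM => //; rewrite ?expR_ge0//.
    by rewrite ler_expR le_max lexx orbT.
  exists T; split => //; apply: (le_trans (ler_norm _)).
  apply: (@le_trans _ _ (`|hX (expR T)| * expR (`|p1| * T) * boyd_majorant p1 p2 t)).
    rewrite -mulrA ler_peMr// -expRD -expR0 ler_expR.
    suff : - (`|p1| * T) <= Num.max (p1 * t) (p2 * t) by lra.
    rewrite le_max; apply/orP; left.
    rewrite lerNl; apply: (le_trans (ler_norm _)); rewrite normrN normrM.
    by apply: ler_wpM2l => //; rewrite ler_norml tT Tt.
  by rewrite ler_pM2r ?expR_gt0// /C lerDr.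
apply: (le_trans (hX_le t r x phi f np nf rE tx pf)).
by rewrite lee_fin ler_wpM2r.
Qed.

Variables (a gm : R -> R) (u v p1 p2 q : R).
Hypotheses (la : circle_lift L a) (u0 : u <= 0) (Lv : L <= v).
Hypotheses (au : a u = u) (av : a v = v).
Hypotheses (cgm : continuous gm) (gm0 : forall s, 0 <= gm s).
Hypotheses (p1a : p1 < aX) (bp2 : bX < p2).
Hypothesis wq : forall s, a s = s ->
  gm s * boyd_majorant p1 p2 (- ln (derive1 a s)) < q.

Definition cocycle n s := \prod_(k < n) gm (iter k a s).

Lemma cocycle_ge0 n s : 0 <= cocycle n s.
Proof. by apply: prodr_ge0 => k _; exact: gm0. Qed.

Lemma continuous_iter_lift n : continuous (iter n a).
Proof. exact: lift_continuous (circle_lift_iter n la). Qed.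

Lemma continuous_cocycle n : continuous (cocycle n).
Proof.
rewrite /cocycle; elim: n => [|n IH].
  rewrite (_ : (fun s => _) = cst 1); first exact: cst_continuous.
  by apply/funext => s; rewrite big_ord0.
rewrite (_ : (fun s => _) = fun s => cocycle n s * gm (iter n a s)); last first.
  by apply/funext => s; rewrite /cocycle big_ord_recr.
have cgi : continuous (gm \o iter n a).
  by move=> s; apply: continuous_comp; [exact: continuous_iter_lift|exact: cgm].
by move=> s; apply: cvgM; [exact: IH|exact: cgi].
Qed.

(** The effect of the [n]-th power of [gW] on moduli when [gm] is the modulus of [g], as
    [modulus_iter] shows. *)
Definition wcomp n (F : R -> \bar R) s : \bar R :=
  ((cocycle n s)%:E * F (iter n a s))%E.

Lemma nonneg_meas_wcomp n (F : R -> \bar R) E : measurable_fun setT F ->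
  (forall s, (0 <= F s)%E) -> nonneg_meas E (wcomp n F).
Proof.
move=> mF F0; split; last by move=> s; rewrite mule_ge0// lee_fin cocycle_ge0.
apply: measurable_funTS; apply: emeasurable_funM.
  by apply/measurable_EFinP; apply: continuous_measurable_fun; exact: continuous_cocycle.
apply: (measurableT_comp mF).
by apply: continuous_measurable_fun; exact: continuous_iter_lift.
Qed.

(** The circle is cut into bands where the logarithm of the derivative of [iter n a] varies by less
    than 1. Each band contributes [O(q ^+ n)], and the factor [n.+1] comes from the number of
    bands. *)
Lemma rho_wcomp_le : exists2 C : R, 0 < C & forall n (F : R -> \bar R) r,
  measurable_fun setT F -> (forall s, (0 <= F s)%E) ->
  (forall s, F (s + L) = F s) -> rho F = r%:E ->
  (rho (wcomp n F) <= (C * n.+1%:R * q ^+ n * r)%:E)%E.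
Proof.
have [Bge0 [_ [BZ [_ [Bmono _]]]]] := bfn.
have uv : u <= v by exact: le_trans u0 (le_trans (ltW L0) Lv).
have [C2 C20 boyd] := rho_le_boyd_majorant p1a bp2.
have [B B0 lnB] := ln_derive1_lift_bounded la uv.
have [_ _ ca' a0] := la.
pose H := boyd_majorant p1 p2.
have cH : continuous (fun s => H (- ln (derive1 a s))).
  move=> s; rewrite /H /boyd_majorant.
  apply: continuous_comp; last exact: continuous_expR.
  have cl : {for s, continuous (fun s => - ln (derive1 a s))}.
    by apply: cvgN; exact: (continuous_comp (ca' s) (continuous_ln (a0 s))).
  by apply: continuous_max; apply: cvgM => //; exact: cvg_cst.
have [C1 C10 prodw] : exists2 C : R, 0 < C & forall n s, u <= s <= v ->
    \prod_(k < n) (gm (iter k a s) * H (- ln (derive1 a (iter k a s)))) <= C * q ^+ n.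
  apply: (lift_orbit_prod la uv au av
    (w := fun s => gm s * H (- ln (derive1 a s)))).
  - by move=> s; apply: cvgM; [exact: cgm|exact: cH].
  - by move=> s; rewrite mulr_ge0 ?expR_ge0.
  - exact: wq.
pose N := Num.bound B; have BN : B <= N%:R by exact/ltW/archi_boundP.
pose P := expR (`|p1| + `|p2|).
(* [P] pays for rounding to the grid, [C1] for the product along the orbit, [C2] for the Boyd
   estimate; the first factor belongs to the count of bands. *)
pose C := (N.*2.+1)%:R * (P * C1 * C2).
have C0 : 0 < C by rewrite !mulr_gt0 ?expR_gt0.
exists C => // n F r mF F0 FL rE.
have r0 : 0 <= r.
  by rewrite -lee_fin -rE; apply: Bge0; split => //; exact: measurable_funTS.
have nF : nonneg_meas D F by split => //; exact: measurable_funTS.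
have q0 : 0 <= q.
  by apply: le_trans (ltW (wq au)); rewrite mulr_ge0 ?expR_ge0.
have lan := circle_lift_iter n la.
pose theta s := ln (derive1 (iter n a) s).
have an0 s : 0 < derive1 (iter n a) s by case: lan.
have mtheta : measurable_fun setT theta.
  apply: (measurableT_comp (@measurable_ln R)).
  by apply: continuous_measurable_fun; case: lan.
have thetaB s : u <= s <= v -> `|theta s| <= (n * N)%:R.
  move=> suv; rewrite /theta (ln_derive1_iter la)//.
  apply: (le_trans (ler_norm_sum _ _ _)).
  apply: (@le_trans _ _ (\sum_(k < n) N%:R)).
    apply: ler_sum => k _; apply: (le_trans _ BN); apply: lnB.
    exact: (iter_lift_itv la au av).
  by rewrite sumr_const card_ord natrM mulr_natl.
have cocH s : u <= s <= v -> cocycle n s * H (- theta s) <= C1 * q ^+ n.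
  move=> suv; apply: le_trans (prodw n s suv); rewrite big_split/=.
  apply: ler_wpM2l; first exact: cocycle_ge0.
  rewrite /theta (ln_derive1_iter la)// -sumrN.
  exact: (boyd_majorant_sum p1 p2 n (fun k => - ln (derive1 a (iter k a s)))).
(* As [|theta| <= n N] on the invariant interval, the shift by [n N] lets natural numbers index all
   the bands. *)
pose c j : R := j%:R - (n * N)%:R.
pose E j := theta @^-1` `[c j, c j + 1[%classic.
have mE j : measurable (E j).
  by rewrite -[E j]setTI; apply: mtheta.
pose phi j s := ((\1_(E j) s)%:E * wcomp n F s)%E.
have nphi j : nonneg_meas D (phi j).
  have [mw w0] := nonneg_meas_wcomp n D mF F0.
  split; last by move=> s; rewrite mule_ge0// lee_fin.
  apply: emeasurable_funM => //; apply/measurable_EFinP.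
  exact: measurable_indic.
have rphi j : (rho (phi j) <= (P * C1 * C2 * q ^+ n * r)%:E)%E.
  pose psi s := ((\1_(E j) s)%:E * F (iter n a s))%E.
  have npsi : nonneg_meas D psi.
    split; last by move=> s; rewrite mule_ge0// lee_fin.
    apply: measurable_funTS; apply: emeasurable_funM.
      by apply/measurable_EFinP; exact: measurable_indic.
    apply: (measurableT_comp mF).
    by apply: continuous_measurable_fun; exact: continuous_iter_lift.
  (* On [E j] the derivative is at least [expR (c j)], so the distribution function of [psi] is at
     most [expR (- c j)] times that of [F]. *)
  have psi_le : (rho psi <= (C2 * H (- c j) * r)%:E)%E.
    apply: (boyd _ _ _ F) => // y y0.
    have -> : distr L psi y =
        mu (D `&` (E j `&` [set s | (y%:E < F (iter n a s))%E])).
      rewrite /distr; congr (mu _); congr (_ `&` _).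
      apply/seteqP; split => s; rewrite /psi /= indicE.
        case: (boolP (s \in E j)) => [sE|_]; last first.
          by rewrite mul0e lte_fin ltNge y0.
        by rewrite mul1e; split => //; rewrite inE in sE.
      by move=> [sE yF]; rewrite mem_set// mul1e.
    have := measure_superlevel_comp_lift L0 y lan (mE j) mF FL (expR_ge0 (c j)).
    have mb s : E j s -> expR (c j) <= derive1 (iter n a) s.
      rewrite /E /= in_itv/= => /andP[h _].
      by rewrite -[leRHS]lnK ?posrE// ler_expR.
    move=> /(_ mb) h.
    by rewrite expRN -[leLHS]mul1e -(@mulVf _ (expR (c j))) ?gt_eqF ?expR_gt0//
      EFinM -muleA; apply: lee_wpmul2l => //; rewrite lee_fin invr_ge0 expR_ge0.
  (* The pointwise bound of the cocycle on the band, obtained from [cocH] with [theta] rounded to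
     [c j]. Its denominator cancels the factor [H (- c j)] of [psi_le]. *)
  pose K := C1 * q ^+ n * P / H (- c j).
  have K0 : 0 <= K.
    by rewrite divr_ge0 ?expR_ge0// !mulr_ge0 ?expR_ge0 ?exprn_ge0// ltW.
  apply: (@le_trans _ _ (rho (fun s => K%:E * psi s)%E)).
    apply: Bmono => //.
      split; last by move=> s; rewrite mule_ge0 ?lee_fin//; case: npsi.
      by apply: emeasurable_funM => //; case: npsi.
    apply: aeW => s /=; rewrite in_itv/= => /andP[s0 sL].
    rewrite /phi /psi /wcomp indicE; case: (boolP (s \in E j)) => [|_]; last first.
      by rewrite !mul0e mule0.
    rewrite inE /E/= in_itv/= => /andP[h1 h2]; rewrite !mul1e.
    apply: lee_wpmul2r => //; rewrite lee_fin /K ler_pdivlMr ?expR_gt0//.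
    have suv : u <= s <= v by rewrite (le_trans u0 s0) (le_trans (ltW sL) Lv).
    apply: (@le_trans _ _ (cocycle n s * (P * H (- theta s)))).
      apply: ler_wpM2l; first exact: cocycle_ge0.
      by apply: boyd_majorant_lip; rewrite ler_norml; apply/andP; split; lra.
    by rewrite mulrCA mulrC ler_pM2r ?expR_gt0//; exact: cocH.
  rewrite BZ//.
  apply: (@le_trans _ _ (K%:E * (C2 * H (- c j) * r)%:E)%E).
    by apply: lee_wpmul2l.
  rewrite -EFinM lee_fin le_eqVlt; apply/orP; left; apply/eqP.
  by rewrite /K; field; rewrite gt_eqF// expR_gt0.
(* The bands are half-open, so one more than [2 n N] of them is needed to include [theta = n N]. *)
pose m := (n * N).*2.+1.
apply: (@le_trans _ _ (rho (fun s => \sum_(j < m) phi j s)%E)).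
  apply: Bmono; [exact: nonneg_meas_sum|exact: nonneg_meas_wcomp|].
  apply: aeW => s /=; rewrite in_itv/= => /andP[s0 sL].
  have suv : u <= s <= v by rewrite (le_trans u0 s0) (le_trans (ltW sL) Lv).
  have := thetaB s suv; rewrite ler_norml => /andP[t1 t2].
  have [j jm sj] : exists2 j, (j < m)%N & E j s.
    pose z := theta s + (n * N)%:R.
    have z0 : 0 <= z by rewrite /z; lra.
    have /andP[z1 z2] := truncn_itv z0.
    exists (Num.truncn z).
      rewrite /m ltnS -(ler_nat R); apply: (le_trans z1).
      by rewrite -muln2 natrM /z; lra.
    rewrite /E /= in_itv/= /c; move: z1 z2; rewrite -natr1 /z => z1 z2.
    by apply/andP; split; lra.
  rewrite (bigD1 (Ordinal jm))//= {1}/phi indicE mem_set// mul1e leeDl//.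
  by apply: sume_ge0 => i _; case: (nphi i).
apply: (le_trans (@rho_sum_le m phi (fun=> P * C1 * C2 * q ^+ n * r) nphi (fun j _ => rphi j))).
rewrite lee_fin sumr_const card_ord -[leLHS]mulr_natl.
set X := P * C1 * C2 * q ^+ n * r.
have X0 : 0 <= X by rewrite !mulr_ge0 ?expR_ge0 ?exprn_ge0// ltW.
rewrite [leRHS](_ : _ = (N.*2.+1 * n.+1)%:R * X); last by rewrite natrM /C /X; ring.
apply: ler_wpM2r => //; rewrite ler_nat /m.
rewrite mulSn addSn ltnS doubleMr mulnC.
by apply: (leq_trans _ (leq_addl _ _)); rewrite leq_mul2l leqnSn orbT.
Qed.

End Boyd.

(** * Complex sequences and series by real and imaginary parts *)

Section ComplexSequences.
Variable R : realType.
Implicit Types z w : nat -> R[i].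

Lemma ReD (x y : R[i]) : complex.Re (x + y) = complex.Re x + complex.Re y.
Proof. by case: x y => [? ?] [? ?]. Qed.

Lemma ImD (x y : R[i]) : complex.Im (x + y) = complex.Im x + complex.Im y.
Proof. by case: x y => [? ?] [? ?]. Qed.

Lemma ReM (x y : R[i]) : complex.Re (x * y) =
  complex.Re x * complex.Re y - complex.Im x * complex.Im y.
Proof. by case: x y => [? ?] [? ?]. Qed.

Lemma ImM (x y : R[i]) : complex.Im (x * y) =
  complex.Re x * complex.Im y + complex.Im x * complex.Re y.
Proof. by case: x y => [? ?] [? ?]. Qed.

Lemma normcE (x : R[i]) :
  Normc.normc x = Num.sqrt (complex.Re x ^+ 2 + complex.Im x ^+ 2).
Proof. by case: x. Qed.

Lemma normc_ge0 (x : R[i]) : 0 <= Normc.normc x.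
Proof. by rewrite normcE sqrtr_ge0. Qed.

Lemma normc_eq0 (x : R[i]) : (Normc.normc x == 0) = (x == 0).
Proof.
apply/eqP/eqP => [/Normc.eq0_normc//|->].
by rewrite normcE/= expr0n addr0 sqrtr0.
Qed.

Lemma Re_le_normc (x : R[i]) : `|complex.Re x| <= Normc.normc x.
Proof. by rewrite normcE -sqrtr_sqr ler_wsqrtr// lerDl sqr_ge0. Qed.

Lemma Im_le_normc (x : R[i]) : `|complex.Im x| <= Normc.normc x.
Proof. by rewrite normcE -sqrtr_sqr ler_wsqrtr// lerDr sqr_ge0. Qed.

Lemma normc_le_ReIm (x : R[i]) :
  Normc.normc x <= `|complex.Re x| + `|complex.Im x|.
Proof.
rewrite normcE -[leRHS]ger0_norm ?addr_ge0// -sqrtr_sqr ler_wsqrtr//.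
rewrite sqrrD !real_normK ?num_real// -addrA lerD2l lerDr.
by rewrite mulrn_wge0// mulr_ge0.
Qed.

Definition cvgC z (l : R[i]) : Prop :=
  ((fun n => complex.Re (z n)) @ \oo --> complex.Re l) /\
  ((fun n => complex.Im (z n)) @ \oo --> complex.Im l).

(* The value is meaningful only for convergent [z]; the upper limits make it
   depend measurably on parameters in all cases. *)
Definition limC z : R[i] :=
  Complex (fine (limn_esup (fun n => (complex.Re (z n))%:E)))
          (fine (limn_esup (fun n => (complex.Im (z n))%:E))).

Lemma cvgC_lim z l : cvgC z l -> limC z = l.
Proof.
have fl (v : nat -> R) (x : R) : v @ \oo --> x -> fine (limn_esup (fun n => (v n)%:E)) = x.
  move=> vx; have : (fun n => (v n)%:E) @ \oo --> x%:E.
    by apply: cvg_EFin => //; exact: nearW.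
  by move=> /cvg_limn_einf_sup[_ ->].
by case: l => x y [/= zx zy]; rewrite /limC (fl _ _ zx) (fl _ _ zy).
Qed.

Lemma cvgC_cst c : cvgC (fun=> c) c.
Proof. by split; exact: cvg_cst. Qed.

Lemma cvgCD z w l m : cvgC z l -> cvgC w m -> cvgC (fun n => z n + w n) (l + m).
Proof.
move=> [z1 z2] [w1 w2]; split.
  by rewrite ReD; under eq_fun do rewrite ReD; exact: cvgD.
by rewrite ImD; under eq_fun do rewrite ImD; exact: cvgD.
Qed.

Lemma cvgCM c z l : cvgC z l -> cvgC (fun n => c * z n) (c * l).
Proof.
move=> [z1 z2]; split.
  rewrite ReM; under eq_fun do rewrite ReM.
  by apply: cvgB; apply: cvgM => //; exact: cvg_cst.
rewrite ImM; under eq_fun do rewrite ImM.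
by apply: cvgD; apply: cvgM => //; exact: cvg_cst.
Qed.

Lemma cvgCS z l : cvgC z l -> cvgC (fun n => z n.+1) l.
Proof. 
move=> [z1 z2]; split.
  by rewrite (cvg_shiftS (fun n => complex.Re (z n))).
by rewrite (cvg_shiftS (fun n => complex.Im (z n))).
 Qed.

Lemma cvgC_uniq z l m : cvgC z l -> cvgC z m -> l = m.
Proof. by move=> /cvgC_lim <- /cvgC_lim. Qed.

Lemma abs_cvg_series (t b : nat -> R) (B : R) : (forall n, `|t n| <= b n) ->
  (forall N, \sum_(n < N) b n <= B) ->
  exists2 l : R, (fun N => \sum_(n < N) t n) @ \oo --> l & `|l| <= B.
Proof.
move=> tb bB.
have cvt : cvgn (series t).
  apply: normed_cvg; apply: nondecreasing_is_cvgn.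
    by apply: nondecreasing_series => n _ _; exact: normr_ge0.
  exists B => _ [N _ <-]; apply: le_trans (bB N).
  rewrite -(big_mkord predT); apply: ler_sum => n _; exact: tb.
have tE : (fun N => \sum_(n < N) t n) = series t.
  by apply/funext => N; rewrite /series/= big_mkord.
exists (limn (series t)); first by rewrite tE.
rewrite -[leLHS]/(`| limn (series t) |) -lim_norm//.
apply: limr_le; first exact: is_cvg_norm.
apply: nearW => N; apply: le_trans (bB N); rewrite -tE.
by apply: (le_trans (ler_norm_sum _ _ _)); apply: ler_sum.
Qed.

(** The factor 2 comes from bounding the real and imaginary parts of the sum separately. *)
Lemma abs_cvgC_series (t : nat -> R[i]) (b : nat -> R) (B : R) :
  (forall n, Normc.normc (t n) <= b n) -> (forall N, \sum_(n < N) b n <= B) ->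
  exists2 l, cvgC (fun N => \sum_(n < N) t n) l & Normc.normc l <= 2 * B.
Proof.
move=> tb bB.
have Resum N : complex.Re (\sum_(n < N) t n) = \sum_(n < N) complex.Re (t n).
  by elim/big_ind2: _ => // x y z w <- <-; rewrite ReD.
have Imsum N : complex.Im (\sum_(n < N) t n) = \sum_(n < N) complex.Im (t n).
  by elim/big_ind2: _ => // x y z w <- <-; rewrite ImD.
have [x cx xB] := @abs_cvg_series (fun n => complex.Re (t n)) b B
  (fun n => le_trans (Re_le_normc _) (tb n)) bB.
have [y cy yB] := @abs_cvg_series (fun n => complex.Im (t n)) b B
  (fun n => le_trans (Im_le_normc _) (tb n)) bB.
exists (Complex x y).
  split => /=; first by under eq_fun do rewrite Resum.
  by under eq_fun do rewrite Imsum.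
apply: (le_trans (normc_le_ReIm _)) => /=; lra.
Qed.

End ComplexSequences.

(** * Monotonicity of almost-everywhere statements *)

Section AlmostEverywhere.
Variable R : realType.
Local Notation mu := (@lebesgue_measure R).

Lemma aeS (P Q : R -> Prop) : (forall s, P s -> Q s) ->
  {ae mu, forall s, P s} -> {ae mu, forall s, Q s}.
Proof. by move=> PQ; apply: negligibleS => s; apply: contra_not; exact: PQ. Qed.

Lemma aeS2 (P Q S : R -> Prop) : (forall s, P s -> Q s -> S s) ->
  {ae mu, forall s, P s} -> {ae mu, forall s, Q s} -> {ae mu, forall s, S s}.
Proof.
move=> PQS nP nQ; apply: negligibleS (negligibleU nP nQ) => s nS.
apply: contrapT => /not_orP[/contrapT Ps /contrapT Qs].
by apply: nS; exact: PQS.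
Qed.

End AlmostEverywhere.

(** * The Neumann series, under a geometric bound on the powers of [gW] *)

Section Neumann.
Variables (R : realType) (g1 g2 : R -> R) (L : R) (alpha : R * R -> R * R).
Variables (a : R -> R) (rho : (R -> \bar R) -> \bar R) (g : R * R -> R[i]).
Local Notation mu := (@lebesgue_measure R).
Local Notation D := (`[0, L[%classic : set R).
Local Notation pt s := (g1 s, g2 s).
Local Notation A := (gW g alpha).
Hypotheses (L0 : 0 < L) (la : circle_lift L a).
Hypothesis gammaL : forall s, pt (s + L) = pt s.
Hypothesis alphaE : forall s, alpha (pt s) = pt (a s).
Hypothesis bfn : banach_function_norm D rho.
Hypothesis cgR : continuous (fun s => complex.Re (g (pt s))).
Hypothesis cgI : continuous (fun s => complex.Im (g (pt s))).

(** Measurability is asked on the whole line so that it survives composition with [a]; periodicity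
    gives it from [[0, L[]. *)
Definition measC (f : R * R -> R[i]) : Prop :=
  measurable_fun setT (fun s => complex.Re (f (pt s))) /\
  measurable_fun setT (fun s => complex.Im (f (pt s))).

Lemma inX_measC f : inX g1 g2 L rho f -> measC f.
Proof.
move=> [mR [mI _]]; split; apply: (measurable_periodic L0) => //.
  by move=> s; rewrite gammaL.
by move=> s; rewrite gammaL.
Qed.

Lemma measC_inX f : measC f -> (Xnorm g1 g2 rho f < +oo)%E ->
  inX g1 g2 L rho f.
Proof. by move=> [mR mI] fX; split; [|split] => //; exact: measurable_funTS. Qed.

Lemma measCD f h : measC f -> measC h -> measC (fun t => f t + h t).
Proof.
move=> [f1 f2] [h1 h2]; split.
  by under eq_fun do rewrite ReD; exact: measurable_funD.
by under eq_fun do rewrite ImD; exact: measurable_funD.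
Qed.

Lemma measCZ c f : measC f -> measC (fun t => c * f t).
Proof.
move=> [f1 f2]; split.
  under eq_fun do rewrite ReM.
  by apply: measurable_funB; apply: measurable_funM.
under eq_fun do rewrite ImM.
by apply: measurable_funD; apply: measurable_funM.
Qed.

Lemma measC_gW f : measC f -> measC (A f).
Proof.
move=> [f1 f2].
have ma : measurable_fun setT a by exact: measurable_lift la.
have mgR : measurable_fun setT (fun s => complex.Re (g (pt s))).
  exact: continuous_measurable_fun.
have mgI : measurable_fun setT (fun s => complex.Im (g (pt s))).
  exact: continuous_measurable_fun.
have fa1 : measurable_fun setT (fun s => complex.Re (f (pt (a s)))).
  exact: (measurableT_comp f1 ma).
have fa2 : measurable_fun setT (fun s => complex.Im (f (pt (a s)))).
  exact: (measurableT_comp f2 ma).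
split; rewrite /gW.
  under eq_fun do rewrite ReM alphaE.
  by apply: measurable_funB; apply: measurable_funM.
under eq_fun do rewrite ImM alphaE.
by apply: measurable_funD; apply: measurable_funM.
Qed.

Lemma measC_iter n f : measC f -> measC (iter n A f).
Proof. by move=> mf; elim: n => //= n; exact: measC_gW. Qed.

Lemma measurable_modulus f : measC f -> measurable_fun setT (modulus g1 g2 f).
Proof.
move=> [f1 f2]; apply/measurable_EFinP; under eq_fun do rewrite normcE.
apply: (@measurableT_comp _ _ _ _ _ _ (@Num.sqrt R)).
  by apply: continuous_measurable_fun; exact: sqrt_continuous.
by apply: measurable_funD; exact: measurable_funX.
Qed.

Lemma modulus_ge0 f s : (0 <= modulus g1 g2 f s)%E.
Proof. by rewrite lee_fin normc_ge0. Qed.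

Lemma nonneg_meas_modulus f : measC f -> nonneg_meas D (modulus g1 g2 f).
Proof.
move=> mf; split; last exact: modulus_ge0.
by apply: measurable_funTS; exact: measurable_modulus.
Qed.

Lemma gW_add f h t : A (fun t => f t + h t) t = A f t + A h t.
Proof. by rewrite /gW mulrDr. Qed.

Lemma gW_scale c f t : A (fun t => c * f t) t = c * A f t.
Proof. by rewrite /gW mulrCA. Qed.

Lemma iter_gW_add n f h :
  iter n A (fun t => f t + h t) = fun t => iter n A f t + iter n A h t.
Proof.
elim: n => //= n ->; apply/funext => t; exact: gW_add.
Qed.

Lemma iter_gW_scale n c f : iter n A (fun t => c * f t) = fun t => c * iter n A f t.
Proof.
elim: n => //= n ->; apply/funext => t; exact: gW_scale.
Qed.

Variables (lam : R[i]) (K y : R).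
Hypotheses (K0 : 0 <= K) (y0 : 0 <= y) (ylam : y < Normc.normc lam).
Hypothesis normA : forall n f r, inX g1 g2 L rho f -> Xnorm g1 g2 rho f = r%:E ->
  (Xnorm g1 g2 rho (iter n A f) <= (K * y ^+ n * r)%:E)%E.

Let N0 : 0 < Normc.normc lam. Proof. exact: le_lt_trans ylam. Qed.

Let lam0 : lam != 0. Proof. by rewrite -normc_eq0 gt_eqF. Qed.

(** The minus sign is there because [spectrum] is defined through [A - lam]. *)
Definition neumann_sum f N t : R[i] :=
  - \sum_(n < N) lam^-1 ^+ n.+1 * iter n A f t.

(** The limit is taken point by point; for [f] in the space it exists at almost every point of the
    curve, by [majorant_finite_ae] and [neumann_cvg]. *)
Definition neumann f : R * R -> R[i] := fun t => limC (neumann_sum f ^~ t).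

Definition neumann_term f n s : R :=
  (Normc.normc lam)^-1 ^+ n.+1 * Normc.normc (iter n A f (pt s)).

Definition neumann_majorant f s : \bar R :=
  (\sum_(0 <= n <oo) (neumann_term f n s)%:E)%E.

Lemma neumann_term_ge0 f n s : 0 <= neumann_term f n s.
Proof. by rewrite mulr_ge0 ?normc_ge0// exprn_ge0// invr_ge0 ltW. Qed.

Lemma nonneg_meas_term f n : measC f ->
  nonneg_meas D (fun s => (neumann_term f n s)%:E).
Proof.
move=> mf; split; last by move=> s; rewrite lee_fin neumann_term_ge0.
apply: measurable_funTS; rewrite /neumann_term.
under eq_fun do rewrite EFinM.
apply: emeasurable_funM => //.
exact: (measurable_modulus (measC_iter n mf)).
Qed.

Lemma nonneg_meas_majorant f : measC f -> nonneg_meas D (neumann_majorant f).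
Proof.
move=> mf; split; last first.
  by move=> s; apply: nneseries_ge0 => n _ _; rewrite lee_fin neumann_term_ge0.
apply: ge0_emeasurable_sum => [n s _ _|n _].
  by rewrite lee_fin neumann_term_ge0.
by case: (nonneg_meas_term n mf).
Qed.

(** The sum over [n] of [K * y ^+ n / |lam| ^+ n.+1]. *)
Definition resolvent_bound : R := K / (Normc.normc lam - y).

(** The triangle inequality and the geometric series bound the partial sums; the Fatou axiom of the
    norm carries the bound to the limit. *)
Lemma rho_majorant f r : inX g1 g2 L rho f -> Xnorm g1 g2 rho f = r%:E ->
  (rho (neumann_majorant f) <= (resolvent_bound * r)%:E)%E.
Proof.
move=> fX rE; have mf := inX_measC fX.
have [Bge0 [_ [BZ [_ [_ [Bfatou _]]]]]] := bfn.
have r0 : 0 <= r.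
  by rewrite -lee_fin -rE; apply: Bge0; exact: nonneg_meas_modulus.
pose S N s := (\sum_(n < N) (neumann_term f n s)%:E)%E.
have nS N : nonneg_meas D (S N).
  by apply: (nonneg_meas_sum N (phi := fun n s => (neumann_term f n s)%:E)) => n;
    exact: nonneg_meas_term.
have cvS : (fun N => rho (S N)) @ \oo --> rho (neumann_majorant f).
  apply: Bfatou => //; first exact: nonneg_meas_majorant.
  apply: aeW => s _; split.
    move=> N; rewrite /S big_ord_recr/= leeDl// lee_fin.
    exact: neumann_term_ge0.
  under eq_fun do rewrite /S -(big_mkord predT (fun n => (neumann_term f n s)%:E)).
  by apply: is_cvg_nneseries => n _ _; rewrite lee_fin neumann_term_ge0.
apply: (cvge_to_le cvS); apply: nearW => N.
pose x := y / Normc.normc lam.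
have x0 : 0 <= x by rewrite divr_ge0// ltW.
have x1 : x < 1 by rewrite ltr_pdivrMr// mul1r.
have term_le n : (rho (fun s => (neumann_term f n s)%:E) <=
    (K * r / Normc.normc lam * x ^+ n)%:E)%E.
  rewrite /neumann_term; under eq_fun do rewrite EFinM.
  rewrite BZ; last 2 first.
    exact: (nonneg_meas_modulus (measC_iter n mf)).
    by rewrite exprn_ge0// invr_ge0 ltW.
  apply: (@le_trans _ _ (((Normc.normc lam)^-1 ^+ n.+1)%:E * (K * y ^+ n * r)%:E)%E).
    apply: lee_wpmul2l; first by rewrite lee_fin exprn_ge0// invr_ge0 ltW.
    exact: normA.
  rewrite -EFinM lee_fin /x exprMn exprS le_eqVlt; apply/orP; left; apply/eqP; ring.
apply: (le_trans (@rho_sum_le _ _ _ bfn N _ _ (fun n => nonneg_meas_term n mf)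
  (fun n _ => term_le n))).
rewrite lee_fin -big_distrr/=.
have sumx : \sum_(n < N) x ^+ n <= (1 - x)^-1.
  rewrite -[leRHS]mul1r ler_pdivlMr ?subr_gt0// mulrC.
  have -> : (1 - x) * \sum_(n < N) x ^+ n = 1 - x ^+ N.
    by rewrite -[LHS]opprK -mulNr opprB -subrX1 opprB.
  by rewrite gerBl exprn_ge0.
apply: (@le_trans _ _ (K * r / Normc.normc lam * (1 - x)^-1)).
  by apply: ler_wpM2l => //; rewrite divr_ge0 ?mulr_ge0// ltW.
rewrite /resolvent_bound /x le_eqVlt; apply/orP; left; apply/eqP.
by field; rewrite !gt_eqF// subr_gt0.
Qed.

(** The last axiom of the norm, applied to [[0, L[] itself, bounds the integral of the majorant by
    its finite norm. *)
Lemma majorant_finite_ae f : inX g1 g2 L rho f ->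
  {ae mu, forall s, D s -> (neumann_majorant f s < +oo)%E}.
Proof.
move=> fX; have mf := inX_measC fX; have [mM M0] := nonneg_meas_majorant mf.
have [Bge0 [_ [_ [_ [_ [_ [_ Bint]]]]]]] := bfn.
have rfin : Xnorm g1 g2 rho f \is a fin_num.
  rewrite ge0_fin_numE; first by case: fX => _ [].
  by apply: Bge0; exact: nonneg_meas_modulus.
have rM := rho_majorant fX (esym (fineK rfin)).
have muD : (mu D < +oo)%E by rewrite lebesgue_measure_co0 ?ltry ?ltW.
have [CE CEP] := Bint D (measurable_itv _) (@subset_refl _ D) muD.
have : mu.-integrable D (neumann_majorant f).
  apply/integrableP; split => //.
  under eq_integral do rewrite gee0_abs//.
  apply: (le_lt_trans (CEP _ (nonneg_meas_majorant mf))).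
  have rfin' : rho (neumann_majorant f) \is a fin_num.
    rewrite ge0_fin_numE; first by apply: (le_lt_trans rM); rewrite ltry.
    by apply: Bge0; exact: nonneg_meas_majorant.
  by rewrite -(fineK rfin') -EFinM ltry.
move=> iM; apply: filterS (integrable_ae _ iM) => // s h Ds.
by rewrite -ge0_fin_numE//; exact: h.
Qed.

Lemma neumann_cvg f s : (neumann_majorant f s < +oo)%E ->
  exists2 l, cvgC (neumann_sum f ^~ (pt s)) l &
    ((Normc.normc l)%:E <= 2%:E * neumann_majorant f s)%E.
Proof.
move=> Mfin.
have M0 : (0 <= neumann_majorant f s)%E.
  by apply: nneseries_ge0 => n _ _; rewrite lee_fin neumann_term_ge0.
have Mf : neumann_majorant f s \is a fin_num by rewrite ge0_fin_numE.
have [||l cl lB] := @abs_cvgC_series R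
    (fun n => - 1 * (lam^-1 ^+ n.+1 * iter n A f (pt s)))
    (fun n => neumann_term f n s) (fine (neumann_majorant f s)).
- move=> n; rewrite Normc.normcM (_ : Normc.normc (-1) = 1); last first.
    by rewrite normcE/= oppr0 expr0n addr0 sqrrN expr1n sqrtr1.
  rewrite mul1r Normc.normcM /neumann_term ler_wpM2r ?normc_ge0//.
  rewrite le_eqVlt; apply/orP; left; apply/eqP; elim: n.+1 => [|m IH].
    by rewrite !expr0 Normc.normc1.
  by rewrite !exprS Normc.normcM IH Normc.normcV.
- move=> N; rewrite -lee_fin fineK// -sumEFin.
  rewrite -(big_mkord predT (fun n => (neumann_term f n s)%:E)).
  by apply: nneseries_lim_ge => n _ _; rewrite lee_fin neumann_term_ge0.
exists l; last by rewrite -(fineK Mf) -EFinM lee_fin.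
rewrite /neumann_sum; under eq_fun do rewrite -mulN1r big_distrr/=.
exact: cl.
Qed.

Lemma neumannE f s l : cvgC (neumann_sum f ^~ (pt s)) l -> neumann f (pt s) = l.
Proof. exact: cvgC_lim. Qed.

Lemma measC_neumann f : measC f -> measC (neumann f).
Proof.
move=> mf.
have mS N : measC (neumann_sum f N).
  have -> : neumann_sum f N =
      (fun t => (-1) * \sum_(n < N) lam^-1 ^+ n.+1 * iter n A f t).
    by apply/funext => t; rewrite mulN1r.
  apply: measCZ; elim: N => [|N IH].
    rewrite (_ : (fun _ => _) = fun=> 0); first by split; exact: measurable_cst.
    by apply/funext => t; rewrite big_ord0.
  rewrite (_ : (fun _ => _) = (fun t => \sum_(n < N) lam^-1 ^+ n.+1 * iter n A f t +
      lam^-1 ^+ N.+1 * iter N A f t)); last first.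
    by apply/funext => t; rewrite big_ord_recr.
  by apply: measCD => //; apply: measCZ; exact: measC_iter.
have mfine : measurable_fun setT (@fine R) by exact: fine_measurable.
split; rewrite /neumann /limC /=.
  apply: (measurableT_comp mfine); apply: measurable_fun_limn_esup => N.
  by apply/measurable_EFinP; case: (mS N).
apply: (measurableT_comp mfine); apply: measurable_fun_limn_esup => N.
by apply/measurable_EFinP; case: (mS N).
Qed.

Lemma Xnorm_neumann f : inX g1 g2 L rho f ->
  (Xnorm g1 g2 rho (neumann f) <= (2 * resolvent_bound)%:E * Xnorm g1 g2 rho f)%E.
Proof.
move=> fX; have mf := inX_measC fX.
have [Bge0 [_ [BZ [_ [Bmono _]]]]] := bfn.
have rfin : Xnorm g1 g2 rho f \is a fin_num.
  rewrite ge0_fin_numE; first by case: fX => _ [].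
  by apply: Bge0; exact: nonneg_meas_modulus.
have nM := nonneg_meas_majorant mf.
apply: (@le_trans _ _ (rho (fun s => 2%:E * neumann_majorant f s)%E)).
  apply: Bmono.
  - split; last by move=> s; rewrite mule_ge0 ?lee_fin//; case: nM.
    by apply: emeasurable_funM => //; case: nM.
  - exact: (nonneg_meas_modulus (measC_neumann mf)).
  - apply: aeS (majorant_finite_ae fX) => s h Ds.
    have [l cl lB] := neumann_cvg (h Ds).
    by rewrite /modulus (neumannE cl).
rewrite BZ//; rewrite EFinM -muleA; apply: lee_wpmul2l => //.
rewrite -(fineK rfin) -EFinM.
exact: (rho_majorant fX (esym (fineK rfin))).
Qed.

Lemma neumann_inX f : inX g1 g2 L rho f -> inX g1 g2 L rho (neumann f).
Proof.
move=> fX; have mf := inX_measC fX; apply: measC_inX; first exact: measC_neumann.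
apply: (le_lt_trans (Xnorm_neumann fX)).
have [Bge0 _] := bfn.
have rfin : Xnorm g1 g2 rho f \is a fin_num.
  rewrite ge0_fin_numE; first by case: fX => _ [].
  by apply: Bge0; exact: nonneg_meas_modulus.
by rewrite -(fineK rfin) -EFinM ltry.
Qed.

Lemma neumann_sum_add f h N t :
  neumann_sum (fun t => f t + h t) N t = neumann_sum f N t + neumann_sum h N t.
Proof.
rewrite /neumann_sum -opprD -big_split/=; congr (- _); apply: eq_bigr => n _.
by rewrite iter_gW_add mulrDr.
Qed.

Lemma neumann_sum_scale c f N t :
  neumann_sum (fun t => c * f t) N t = c * neumann_sum f N t.
Proof.
rewrite /neumann_sum mulrN big_distrr/=; congr (- _); apply: eq_bigr => n _.
by rewrite iter_gW_scale mulrCA.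
Qed.

Lemma neumann_add f h : inX g1 g2 L rho f -> inX g1 g2 L rho h ->
  Xeq g1 g2 L (neumann (fun t => f t + h t)) (fun t => neumann f t + neumann h t).
Proof.
move=> fX hX; apply: aeS2 (majorant_finite_ae fX) (majorant_finite_ae hX).
move=> s fs hs Ds; rewrite /on_curve.
have [l cl _] := neumann_cvg (fs Ds); have [m cm _] := neumann_cvg (hs Ds).
rewrite (neumannE cl) (neumannE cm); apply: neumannE.
by under eq_fun do rewrite neumann_sum_add; exact: cvgCD.
Qed.

Lemma neumann_scale f c : inX g1 g2 L rho f ->
  Xeq g1 g2 L (neumann (fun t => c * f t)) (fun t => c * neumann f t).
Proof.
move=> fX; apply: aeS (majorant_finite_ae fX) => s fs Ds; rewrite /on_curve.
have [l cl _] := neumann_cvg (fs Ds).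
rewrite (neumannE cl); apply: neumannE.
by under eq_fun do rewrite neumann_sum_scale; exact: cvgCM.
Qed.

(** The difference has norm 0, so its majorant vanishes almost everywhere and with it every iterate
    of [gW] on the difference. At such points all partial sums for [f] and [h] coincide. *)
Lemma neumann_congr f h : inX g1 g2 L rho f -> inX g1 g2 L rho h ->
  Xeq g1 g2 L f h -> Xeq g1 g2 L (neumann f) (neumann h).
Proof.
move=> fX hX fh; have [Bge0 [B0 _]] := bfn.
have [mf mh] := (inX_measC fX, inX_measC hX).
pose k t := f t + (-1) * h t.
have mk : measC k by apply: measCD => //; exact: measCZ.
have k0 : Xnorm g1 g2 rho k = 0%:E.
  apply/B0; first exact: nonneg_meas_modulus.
  apply: aeS fh => s h' Ds; rewrite /modulus /k.
  move: (h' Ds); rewrite /on_curve => ->.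
  by rewrite mulN1r subrr Normc.normc0.
have kX : inX g1 g2 L rho k by apply: measC_inX => //; rewrite k0 ltry.
have := rho_majorant kX k0; rewrite mulr0 => rM.
have nM := nonneg_meas_majorant mk.
have : rho (neumann_majorant k) = 0%E.
  by apply/eqP; rewrite eq_le rM Bge0.
move=> /(B0 _ nM); apply: aeS => s M0 Ds; rewrite /on_curve /neumann.
congr limC; apply/funext => N; rewrite /neumann_sum; congr (- _).
apply: eq_bigr => n _; congr (_ * _).
have : (neumann_term k n s)%:E = 0%E.
  apply/eqP; rewrite eq_le; apply/andP; split; last by rewrite lee_fin neumann_term_ge0.
  rewrite -(M0 Ds).
  apply: (@le_trans _ _ (\sum_(0 <= i < n.+1) (neumann_term k i s)%:E)%E).
    by rewrite big_nat_recr//= leeDr// sume_ge0// => i _; rewrite lee_fin neumann_term_ge0.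
  by apply: nneseries_lim_ge => i _ _; rewrite lee_fin neumann_term_ge0.
move=> /eqP; rewrite eqe mulf_eq0 expf_eq0/= invr_eq0 gt_eqF//= normc_eq0.
rewrite /k iter_gW_add iter_gW_scale mulN1r subr_eq0 => /eqP; exact.
Qed.

Lemma neumann_bounded : bounded_op g1 g2 L rho neumann.
Proof.
split; first exact: neumann_inX.
split; first exact: neumann_congr.
split; first exact: neumann_add.
split; first exact: neumann_scale.
by exists (2 * resolvent_bound) => f; exact: Xnorm_neumann.
Qed.

(** The resolvent identity at the level of partial sums: applying [gW] shifts the series by one
    index and leaves its first term over. *)
Lemma neumann_sum_shift f N s :
  g (pt s) * neumann_sum f N (alpha (pt s)) =
  lam * neumann_sum f N.+1 (pt s) + f (pt s).
Proof.
rewrite /neumann_sum big_ord_recl/= expr1 !mulrN mulrDr opprD.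
rewrite mulVKf// [RHS]addrC addrA subrr add0r; congr (- _).
rewrite !big_distrr/=; apply: eq_bigr => n _; rewrite /gW.
by rewrite [in RHS]exprS -!mulrA mulVKf//; ring.
Qed.

Lemma neumann_right_inverse f : inX g1 g2 L rho f ->
  Xeq g1 g2 L (fun t => A (neumann f) t - lam * neumann f t) f.
Proof.
move=> fX; apply: aeS (majorant_finite_ae fX) => s fs Ds; rewrite /on_curve.
have [l cl _] := neumann_cvg (fs Ds); rewrite (neumannE cl) /gW.
have cg : cvgC (fun N => g (pt s) * neumann_sum f N (alpha (pt s))) (lam * l + f (pt s)).
  under eq_fun do rewrite neumann_sum_shift.
  apply: cvgCD; last exact: cvgC_cst.
  by apply: cvgCM; exact: (cvgCS cl).
(* Convergence is known at [s] but not at [a s], where [neumann f] is evaluated. If [g] is nonzero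
   at the point, it follows from the convergence of the product [cg]; if [g] is zero there, the
   value at [a s] is multiplied by 0. *)
have [g0|g0] := eqVneq (g (pt s)) 0.
  have : cvgC (fun=> 0) (lam * l + f (pt s)).
    by move: cg; rewrite g0; under eq_fun do rewrite mul0r.
  move=> /(cvgC_uniq (cvgC_cst 0)) e; rewrite g0 mul0r.
  by apply/eqP; rewrite subr_eq addrC -e.
have : cvgC (fun N => neumann_sum f N (alpha (pt s))) ((g (pt s))^-1 * (lam * l + f (pt s))).
  have := cvgCM (g (pt s))^-1 cg.
  by under eq_fun do rewrite mulKf//.
rewrite alphaE => /neumannE ->.
by rewrite mulVKf// addrAC subrr add0r.
Qed.

Lemma neumann_left_inverse f : inX g1 g2 L rho f ->
  Xeq g1 g2 L (neumann (fun t => A f t - lam * f t)) f.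
Proof.
move=> fX; apply: aeS (majorant_finite_ae fX) => s fs Ds; rewrite /on_curve.
have [l cl _] := neumann_cvg (fs Ds); apply: neumannE.
(* The last two terms cancel in the limit, because [N] and [N.+1] give the same limit. *)
have sumE N : neumann_sum (fun t => A f t - lam * f t) N (pt s) =
    f (pt s) + - lam * neumann_sum f N (pt s) + lam * neumann_sum f N.+1 (pt s).
  have -> : (fun t => A f t - lam * f t) = (fun t => A f t + - lam * f t).
    by apply/funext => t; rewrite mulNr.
  rewrite neumann_sum_add neumann_sum_scale addrAC addrC [RHS]addrC; congr (_ + _).
  rewrite [RHS]addrC -neumann_sum_shift /neumann_sum mulrN; congr (- _).
  rewrite big_distrr/=; apply: eq_bigr => n _.
  by rewrite -iterSr iterS /gW mulrCA.
under eq_fun do rewrite sumE.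
rewrite -[X in cvgC _ X](_ : f (pt s) + - lam * l + lam * l = f (pt s)); last by ring.
apply: cvgCD; first by apply: cvgCD; [exact: cvgC_cst|exact: cvgCM].
by apply: cvgCM; exact: (cvgCS cl).
Qed.

Lemma not_in_spectrum : ~ spectrum g1 g2 L rho A lam.
Proof.
apply; exists neumann; split; first exact: neumann_bounded.
by split; [exact: neumann_right_inverse|exact: neumann_left_inverse].
Qed.

End Neumann.

(** * The derivative of [alpha] on the curve and in the arclength parameter *)

Section Curve.
Variables (R : realType) (g1 g2 : R -> R).
Local Notation pt s := (g1 s, g2 s).

Lemma derivable_quotient (F : R -> R) (s : R) : derivable F s 1 ->
  (fun h : R => h^-1 * (F (h + s) - F s)) @ (0 : R)^' --> derive1 F s.
Proof.
rewrite /derivable /= (_ : (fun h => _) = (fun h => h^-1 *: (F (h + s) - F s)))//.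
by apply/funext => h; rewrite /= /GRing.scale/= mulr1.
Qed.

Lemma pdist_quotient (F1 F2 : R -> R) (s : R) :
  derivable F1 s 1 -> derivable F2 s 1 ->
  (fun h : R => pdist (F1 (h + s), F2 (h + s)) (F1 s, F2 s) / `|h|) @ (0 : R)^' -->
  Num.sqrt (derive1 F1 s ^+ 2 + derive1 F2 s ^+ 2).
Proof.
move=> /derivable_quotient d1 /derivable_quotient d2.
rewrite (_ : (fun h => _) = (fun h =>
  Num.sqrt ((h^-1 * (F1 (h + s) - F1 s)) ^+ 2 + (h^-1 * (F2 (h + s) - F2 s)) ^+ 2))).
  apply: continuous_cvg; first exact: sqrt_continuous.
  by apply: cvgD; rewrite !expr2; apply: cvgM.
apply/funext => h; rewrite /pdist/= !exprMn -mulrDr sqrtrM ?sqr_ge0//.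
by rewrite sqrtr_sqr normfV mulrC.
Qed.

Hypothesis d1 : forall s, derivable g1 s 1.
Hypothesis d2 : forall s, derivable g2 s 1.

Lemma continuous_curve : continuous (fun s => pt s).
Proof.
move=> s; have cd (F : R -> R) : derivable F s 1 -> F @ s --> F s.
  by move=> dF; exact/differentiable_continuous/derivable1_diffP.
exact: (@cvg_pair _ _ _ (nbhs s) (nbhs (g1 s)) (nbhs (g2 s)) _ _ _ g1 g2
  (cd _ (@d1 s)) (cd _ (@d2 s))).
Qed.

Lemma continuous_on_curve (h : R * R -> R) :
  {within curve g1 g2, continuous h} -> continuous (fun s => h (pt s)).
Proof.
move=> /subspace_continuousP ch s.
have cs : curve g1 g2 (pt s) by exists s.
apply: (cvg_comp (fun s => pt s) h _ (ch _ cs)).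
move=> P nP; have ns : \forall x \near s, curve g1 g2 (pt x) -> P (pt x).
  exact: (continuous_curve nP).
change (\forall x \near s, P (pt x)).
by apply: filterS ns => x; apply; exists x.
Qed.

Hypothesis unit_speed : forall s, derive1 g1 s ^+ 2 + derive1 g2 s ^+ 2 = 1.

(** Divided by [|h|], the two chords tend to the speeds [derive1 a s] and 1, since the
    parametrization has unit speed. The limit along the curve is then pulled back to the
    parameter. *)
Lemma dilatation_of_lift (L : R) (alpha : R * R -> R * R) (a : R -> R) s (d : R) :
  circle_lift L a -> (forall s, alpha (pt s) = pt (a s)) ->
  (fun t => pdist (alpha t) (alpha (pt s)) / pdist t (pt s))
    @ within (curve g1 g2 `\ pt s) (nbhs (pt s)) --> d ->
  d = derive1 a s.
Proof.
move=> la aE cd; have [_ da _ a0] := la.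
have q1 := pdist_quotient (@d1 s) (@d2 s); rewrite unit_speed sqrtr1 in q1.
have q2 : (fun h : R => pdist (pt (a (h + s))) (pt (a s)) / `|h|) @ (0 : R)^' --> derive1 a s.
  have dc (F : R -> R) : derivable F (a s) 1 -> derivable (F \o a) s 1.
    by move=> dF; apply/derivable1_diffP; apply: differentiable_comp; exact/derivable1_diffP.
  have := pdist_quotient (dc _ (@d1 (a s))) (dc _ (@d2 (a s))).
  rewrite (derive1_comp (@da s) (@d1 (a s))) (derive1_comp (@da s) (@d2 (a s))).
  by rewrite !exprMn -mulrDl unit_speed mul1r sqrtr_sqr (gtr0_norm (a0 s)).
(* Unit speed separates nearby points of the curve. This justifies the division and places
   [pt (h + s)] in the punctured curve. *)
have nz : \forall h \near (0 : R)^', pdist (pt (h + s)) (pt s) != 0.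
  near=> h; have : 0 < pdist (pt (h + s)) (pt s) / `|h|.
    by near: h; exact: (cvgr_gt _ q1 _ ltr01).
  by apply: contraTneq => ->; rewrite mul0r ltxx.
have q3 : (fun h : R => pdist (pt (a (h + s))) (pt (a s)) / pdist (pt (h + s)) (pt s))
    @ (0 : R)^' --> derive1 a s.
  have q : (fun h : R => pdist (pt (a (h + s))) (pt (a s)) / `|h| *
      (pdist (pt (h + s)) (pt s) / `|h|)^-1) @ (0 : R)^' --> derive1 a s * 1^-1.
    by apply: cvgM => //; apply: cvgV => //; exact: oner_neq0.
  rewrite invr1 mulr1 in q; apply: cvg_trans q; apply: near_eq_cvg; near=> h.
  have h0 : h != 0 by near: h; exact: nbhs_dnbhs_neq.
  have p0 : pdist (pt (h + s)) (pt s) != 0 by near: h.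
  by rewrite /=; field; rewrite normr_eq0 h0 p0.
apply: (cvg_unique _ _ q3) => //.
rewrite (_ : (fun h => _) = (fun t => pdist (alpha t) (alpha (pt s)) / pdist t (pt s))
   \o (fun h => pt (h + s))); last by apply/funext => h /=; rewrite !aE.
apply: (cvg_comp _ _ _ cd).
have ch : (fun h : R => pt (h + s)) @ (0 : R)^' --> pt s.
  apply: (@cvg_trans _ ((fun h : R => pt (h + s)) @ (0 : R))).
    move=> P nP; change (nbhs (0 : R) (fun h => h != 0 -> P (pt (h + s)))).
    by apply: (@filterS _ (nbhs (0 : R)) _ _ _ _ nP) => h Ph _.
  have c0 : (fun h : R => h + s) @ (0 : R) --> s.
    by rewrite -[X in _ --> X]add0r; apply: cvgD; [exact: cvg_id|exact: cvg_cst].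
  exact: (cvg_comp _ _ c0 (@continuous_curve s)).
move=> P nP; move: nz (ch _ nP); apply: filterS2 => h p0; apply; split.
  by exists (h + s).
by move=> /= e; move: p0; rewrite e /pdist !subrr expr0n addr0 sqrtr0 eqxx.
Unshelve. all: by end_near.
Qed.

End Curve.

(** * Moduli of the iterates of [gW] *)

Section Cocycle.
Variables (R : realType) (g1 g2 : R -> R) (alpha : R * R -> R * R).
Variables (g : R * R -> R[i]) (a : R -> R).
Local Notation pt s := (g1 s, g2 s).
Hypothesis alphaE : forall s, alpha (pt s) = pt (a s).

Lemma modulus_iter n f : modulus g1 g2 (iter n (gW g alpha) f) =
  wcomp a (fun s => Normc.normc (g (pt s))) n (modulus g1 g2 f).
Proof.
apply/funext => s; rewrite /modulus /wcomp -EFinM; congr (_%:E).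
elim: n s => [|n IH] s; first by rewrite /cocycle big_ord0 mul1r.
rewrite iterS {1}/gW Normc.normcM alphaE IH mulrA /cocycle big_ord_recl/= -iterSr iterS.
congr (_ * _ * _); apply: eq_bigr => k _.
by rewrite -[in RHS]iterS iterSr.
Qed.

End Cocycle.

(** * Auxiliary facts on lifts, growth and majorants *)

Lemma derive1_lift_periodic (R : realType) (L : R) (a : R -> R) s :
  circle_lift L a -> derive1 a (s + L) = derive1 a s.
Proof.
move=> [aL _ _ _]; rewrite /derive1.
rewrite (_ : (fun h => h^-1 *: (a (h + (s + L)) - a (s + L))) =
  (fun h => h^-1 *: (a (h + s) - a s)))//.
by apply/funext => h; rewrite addrA !aL opprD addrACA subrr addr0.
Qed.

Lemma circle_lift_shift (R : realType) (L c : R) (a : R -> R) :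
  circle_lift L a -> circle_lift L (fun s => a s + c).
Proof.
move=> [aL da ca a0].
have dE : derive1 (fun s => a s + c) = derive1 a.
  by apply/funext => s; rewrite !derive1E deriveD// derive_cst addr0.
split; rewrite ?dE.
- by move=> s; rewrite aL addrAC.
- by move=> s; apply: derivableD; [exact: da|exact: derivable_cst].
- exact: ca.
- exact: a0.
Qed.

(** Absorbs the factor [n + 1] into a slightly larger ratio. The induction closes because
    [(x - 1) * (1 + (x - 1)^-1) = x] is at least 1. *)
Lemma natS_le_geometric (R : realType) (x : R) n : 1 < x ->
  n.+1%:R <= (1 + (x - 1)^-1) * x ^+ n.
Proof.
move=> x1; have x10 : 0 < x - 1 by rewrite subr_gt0.
have i0 : 0 < (x - 1)^-1 by rewrite invr_gt0.
elim: n => [|n IH]; first by rewrite mulr1 lerDl ltW.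
have h : 1 <= (x - 1) * ((1 + (x - 1)^-1) * x ^+ n).
  rewrite mulrA mulrDr mulr1 mulfV ?gt_eqF//.
  rewrite -[leLHS]mulr1; apply: ler_pM => //; first by rewrite lerDr ltW.
  by rewrite exprn_ege1// ltW.
rewrite -natr1 exprS mulrCA; move: IH h; set z := (1 + _) * _ => IH h.
lra.
Qed.

(** The cost of moving the exponents off the indices by [e]; it is close to 1 for small [e] when
    [|t|] stays bounded. *)
Lemma boyd_majorantW (R : realType) (p1 p2 e t : R) : 0 <= e ->
  boyd_majorant (p1 - e) (p2 + e) t <= boyd_majorant p1 p2 t * expR (e * `|t|).
Proof.
move=> e0; rewrite /boyd_majorant -expRD ler_expR ge_max.
have h1 : e * t <= e * `|t| by rewrite ler_wpM2l// ler_norm.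
have h2 : - (e * t) <= e * `|t| by rewrite -mulrN ler_wpM2l// -normrN ler_norm.
apply/andP; split.
  by rewrite mulrBl; apply: lerD => //; rewrite le_max lexx.
by rewrite mulrDl; apply: lerD => //; rewrite le_max lexx orbT.
Qed.

Lemma boyd_majorant_powR (R : realType) (p1 p2 d : R) : 0 < d ->
  Num.max (d `^ (- p1)) (d `^ (- p2)) = boyd_majorant p1 p2 (- ln d).
Proof.
move=> d0; rewrite /boyd_majorant /powR gt_eqF// !mulrN !mulNr.
case: (leP (- (p1 * ln d)) (- (p2 * ln d))) => h.
  by apply/max_idPr; rewrite ler_expR.
by apply/max_idPl; rewrite ler_expR ltW.
Qed.

(** * The spectral radius estimate *)

Unset Implicit Arguments.

Theorem theorem3p2 (R : realType)
  (g1 g2 : R -> R) (L : R)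
  (alpha : R * R -> R * R) (dalpha : R * R -> R)
  (rho : (R -> \bar R) -> \bar R) (hX : R -> R) (aX bX : R)
  (g : R * R -> R[i]) :
  smooth_jordan_arclength g1 g2 L ->
  OP_diffeo g1 g2 L alpha ->
  (* dalpha tau = |alpha'(tau)| *)
  (forall tau, curve g1 g2 tau ->
     (fun t => pdist (alpha t) (alpha tau) / pdist t tau)
       @ within (curve g1 g2 `\ tau) (nbhs tau) --> dalpha tau) ->
  (* nonempty set of fixed points *)
  (exists tau, curve g1 g2 tau /\ alpha tau = tau) ->
  (* X(Gamma) is an r.i. Banach function space *)
  banach_function_norm `[0, L[ rho ->
  rearrangement_invariant `[0, L[ rho ->
  (* h_X and Boyd indices *)
  (forall x, 0 < x -> (hX x)%:E = dilation_norm L rho x) ->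
  (fun x => ln (hX x) / ln x) @ 0^'+ --> aX ->
  (fun x => ln (hX x) / ln x) @ +oo --> bX ->
  0 < aX -> aX <= bX -> bX < 1 ->
  (* g in C(Gamma) *)
  {within curve g1 g2, continuous (fun t => complex.Re (g t))} ->
  {within curve g1 g2, continuous (fun t => complex.Im (g t))} ->
  (spectral_radius g1 g2 L rho (gW g alpha) <=
   ereal_sup [set (Normc.normc (g tau) *
                   Num.max (dalpha tau `^ (- aX)) (dalpha tau `^ (- bX)))%:E
             | tau in [set tau | curve g1 g2 tau /\ alpha tau = tau]])%E.
Proof.
move=> [L0 [gL [ginj [dg [_ [_ speed]]]]]] [_ [b [alphab [bL [db [cb b0]]]]]] dalphaP.
move=> [_ [[s0 _ <-] fix0]] bfn ri hXE cvga cvgb _ _ _ cgR cgI.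
have d1 s : derivable g1 s 1 by case: (dg s).
have d2 s : derivable g2 s 1 by case: (dg s).
have gammaL s : (g1 (s + L), g2 (s + L)) = (g1 s, g2 s).
  by case: (gL s) => -> ->.
have gammaDz k s : (g1 (s + L *~ k), g2 (s + L *~ k)) = (g1 s, g2 s).
  exact: (@periodicDz R L _ (fun s => (g1 s, g2 s)) k s gammaL).
(* The parameters [b s0] and [s0] give the same point of the curve; moved into [[0, L[] they agree
   by injectivity. Shifting the lift by [L *~ k] then makes [s0] a fixed point. *)
have [k ks0] : exists k : int, b s0 + L *~ k = s0.
  have [k1 I1] := exists_shift L0 0 (b s0); have [k2 I2] := exists_shift L0 0 s0.
  exists (k1 - k2); rewrite mulrzBr addrA.
  have -> : b s0 + L *~ k1 = s0 + L *~ k2; last by rewrite addrK.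
  apply: ginj; rewrite ?inE ?in_itv/=.
  - by rewrite add0r in I1.
  - by rewrite add0r in I2.
  - by rewrite !gammaDz -alphab.
pose a s := b s + L *~ k.
have la : circle_lift L a by exact: circle_lift_shift.
have alphaE s : alpha (g1 s, g2 s) = (g1 (a s), g2 (a s)).
  by rewrite alphab gammaDz.
have dalphaE s : dalpha (g1 s, g2 s) = derive1 a s.
  have cs : curve g1 g2 (g1 s, g2 s) by exists s.
  exact: (dilatation_of_lift d1 d2 speed la alphaE (dalphaP _ cs)).
have a0 s : 0 < derive1 a s by case: la.
have cgR' := continuous_on_curve d1 d2 cgR.
have cgI' := continuous_on_curve d1 d2 cgI.
pose gm s : R := Normc.normc (g (g1 s, g2 s)).
have gm0 s : 0 <= gm s by exact: normc_ge0.
have cgm : continuous gm.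
  rewrite /gm; under eq_fun do rewrite normcE.
  move=> s; apply: continuous_cvg; first exact: sqrt_continuous.
  by apply: cvgD; rewrite !expr2; apply: cvgM; (exact: cgR' || exact: cgI').
apply: ge_ereal_sup => _ [lam spec <-]; set M := ereal_sup _.
rewrite leNgt; apply/negP => Mlam.
have valM s : a s = s -> ((gm s * boyd_majorant aX bX (- ln (derive1 a s)))%:E <= M)%E.
  move=> as_; apply: ereal_sup_ubound; exists (g1 s, g2 s).
    by split; [exists s|rewrite alphaE as_].
  by rewrite dalphaE boyd_majorant_powR.
have M0 : (0 <= M)%E.
  by apply: le_trans (valM s0 ks0); rewrite lee_fin mulr_ge0 ?expR_ge0.
have Mfin : M \is a fin_num.
  by rewrite ge0_fin_numE//; apply: (lt_trans Mlam); rewrite ltry.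
move: M M0 Mfin Mlam valM => [m| |]// m0 _; rewrite lte_fin lee_fin in m0 * => mlam valM.
set l : R := Normc.normc lam in mlam.
have [u [v [u0 Lv au av]]] := lift_invariant_interval L0 la ks0.
have uv : u <= v by exact: le_trans u0 (le_trans (ltW L0) Lv).
have [B B0 lnB] := ln_derive1_lift_bounded la uv.
(* Fixed points of [a] may lie outside [[u, v]], so the bound is extended by periodicity. *)
have lnB' s : `|ln (derive1 a s)| <= B.
  have [j] := exists_shift L0 0 s; rewrite add0r => /andP[j1 j2].
  rewrite -(@periodicDz R L _ (derive1 a) j s); last first.
    by move=> t; exact: derive1_lift_periodic.
  by apply: lnB; rewrite (le_trans u0 j1) (le_trans (ltW j2) Lv).
(* In the chain [m < m1 < q < y < l], [m1] is positive even if [m = 0], the gap up to [q] pays for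
   the perturbed exponents, and the gap up to [y] absorbs the factor [n + 1]. *)
pose m1 := (m + l) / 2; pose q := (m1 + l) / 2; pose y := (q + l) / 2.
have mm1 : m < m1 by rewrite /m1; lra.
have m1q : m1 < q by rewrite /q /m1; lra.
have qy : q < y by rewrite /y /q /m1; lra.
have yl : y < l by rewrite /y /q /m1; lra.
have m10 : 0 < m1 by exact: le_lt_trans mm1.
have q0 : 0 < q by exact: lt_trans m1q.
(* Chosen so that [expR (e * B) <= q / m1]; the denominator [B + 1] allows [B = 0]. *)
pose e := ln (q / m1) / (B + 1).
have B1 : 0 < B + 1 by rewrite ltr_wpDl.
have qm1 : 1 < q / m1 by rewrite ltr_pdivlMr// mul1r.
have e0 : 0 < e by rewrite divr_gt0// ln_gt0.
have eB : expR (e * B) <= q / m1.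
  have qE : expR (ln (q / m1)) = q / m1 by rewrite lnK// posrE divr_gt0.
  rewrite -[leRHS]qE ler_expR /e mulrAC ler_pdivrMr//.
  by rewrite ler_wpM2l ?ln_ge0 ?(ltW qm1)// lerDl.
have wq s : a s = s ->
    gm s * boyd_majorant (aX - e) (bX + e) (- ln (derive1 a s)) < q.
  move=> as_; have := valM s as_; rewrite lee_fin => wm.
  apply: (@le_lt_trans _ _ (m * (q / m1))); last first.
    by rewrite mulrA ltr_pdivrMr// mulrC ltr_pM2l.
  apply: (@le_trans _ _ (gm s * boyd_majorant aX bX (- ln (derive1 a s)) * expR (e * B))).
    rewrite -mulrA ler_wpM2l//.
    apply: (le_trans (boyd_majorantW _ _ _ (ltW e0))).
    by rewrite ler_wpM2l ?expR_ge0// ler_expR ler_wpM2l ?(ltW e0)// normrN.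
  by apply: ler_pM; rewrite ?expR_ge0 ?mulr_ge0 ?expR_ge0.
have p1a : aX - e < aX by lra.
have bp2 : bX < bX + e by lra.
have [C C0 rhoC] := rho_wcomp_le L0 bfn ri hXE cvga cvgb la u0 Lv au av cgm gm0 p1a bp2 wq.
(* With this ratio [n.+1 * q ^+ n <= c * y ^+ n], which gives the geometric bound on powers with
   constant [C * c]. *)
pose x := y / q.
have x1 : 1 < x by rewrite ltr_pdivlMr// mul1r.
pose c := 1 + (x - 1)^-1.
have c0 : 0 <= c by rewrite addr_ge0// invr_ge0 subr_ge0 ltW.
apply: (not_in_spectrum (K := C * c) (y := y) L0 la gammaL alphaE bfn cgR' cgI' _ _ yl _ spec).
- by rewrite mulr_ge0// ltW.
- by rewrite ltW// (lt_trans q0 qy).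
move=> n f r fX rE; rewrite /Xnorm (modulus_iter _ alphaE).
have mf := inX_measC L0 gammaL fX.
have r0 : 0 <= r.
  by rewrite -lee_fin -rE; apply: bfn.1; exact: nonneg_meas_modulus.
apply: (le_trans (rhoC n _ r _ _ _ rE)).
- exact: measurable_modulus.
- exact: modulus_ge0.
- by move=> s; rewrite /modulus gammaL.
rewrite lee_fin ler_wpM2r// -!mulrA ler_wpM2l ?(ltW C0)//.
apply: (@le_trans _ _ (c * x ^+ n * q ^+ n)).
  by rewrite ler_wpM2r ?exprn_ge0 ?(ltW q0)// natS_le_geometric.
by rewrite -mulrA -exprMn /x divfK// gt_eqF.
Qed.
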